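(* Let $K$ be a compact tree and let $\kappa$ be an uncountable regular cardinal. Define $\Lambda_\kappa(K)=\{x\in K:\chi(K,x)\geq\kappa\}$. Then \[ \mathcal S_{<\kappa}(C(K))\sim c_0(\Lambda_\kappa(K)). \]
   Context: A tree $K$ is a partially ordered set such that for every $x\in K$ the set $\{y\in K:y<x\}$ is well ordered. The interval topology on $K$ is generated by the sets $(s,t]=\{x\in K:s<x\leq t\}$ together with the singletons $\{x\}$ with $x$ minimal in $K$. A compact tree is a tree that is a compact Hausdorff space in its interval topology. $\chi(K,x)$ is the character of $x$ in $K$, i.e. the least cardinality of a local base at $x$. Banach spaces are real, $X\subset X^{**}$ canonically, and $\sim$ denotes linear isomorphism. For an uncountable regular cardinal $\kappa$ and a Banach space $X$, $\Delta_{<\kappa}(X)$ is the norm closure in $X^{**}$ of \[\{x^{**}\in X^{**}:\forall A\subset X^*\text{ with }|A|<\kappa\ \exists x\in X\text{ such that }x^{**}|_A=x|_A\},\] and $\mathcal S_{<\kappa}(X)=\Delta_{<\kappa}(X)/X$. *)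

(* Defs.v *)
From HB Require Import structures.
From mathcomp Require Import all_boot all_order all_algebra.
From mathcomp Require Import ring lra wochoice all_classical all_reals topology normedtype.

Set Implicit Arguments.
Unset Strict Implicit.
Unset Printing Implicit Defensive.

Import Order.TTheory GRing.Theory Num.Theory.
Import numFieldNormedType.Exports.

Local Open Scope classical_set_scope.
Local Open Scope ring_scope.
Local Open Scope card_scope.

(* Cardinals are represented by sets, up to [#=]; a cardinal named [kappa] is a
   type, standing for the cardinality of [set: kappa]. *)
Definition card_lt (T U : Type) (A : set T) (B : set U) : bool :=
  (A #<= B) && (A #!= B).
Notation "A '#<' B" := (card_lt A B) (at level 79) : card_scope.

(* Index sets and members of the union can be taken inside [kappa] itself, since
   every set of cardinality below that of [kappa] embeds in it. *)
Definition regular_cardinal (kappa : Type) : Prop :=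
  infinite_set [set: kappa] /\
  forall (D : set kappa) (F : kappa -> set kappa),
    D #< [set: kappa] -> (forall i, D i -> F i #< [set: kappa]) ->
    \bigcup_(i in D) F i #< [set: kappa].

Definition uncountable_regular_cardinal (kappa : Type) : Prop :=
  regular_cardinal kappa /\ ~ countable [set: kappa].

Section local_base.
Context {T : topologicalType}.

Definition local_base (x : T) (B : set (set T)) : Prop :=
  B `<=` open_nbhs x /\ forall U, nbhs x U -> exists2 V, B V & V `<=` U.

(* The character of [x] is the cardinality of [B]. *)
Definition is_character (x : T) (B : set (set T)) : Prop :=
  local_base x B /\ forall B', local_base x B' -> B #<= B'.

End local_base.

Definition interval_space (K : Type) : Type := K.

Section tree.
Context {d : Order.disp_t} (K : porderType d).

(* [wo_chain r C]: every nonempty subset of [C] has a unique [r]-minimum. *)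
Definition is_tree : Prop :=
  forall x : K, wo_chain <=%O [pred y : K | (y < x)%O].

Definition minimal_point (x : K) : Prop := forall y : K, ~ (y < x)%O.

Definition interval_subbase : set (set K) :=
  [set A | (exists s t : K, A = [set x | (s < x <= t)%O]) \/
           (exists2 x : K, minimal_point x & A = [set x])].

HB.instance Definition _ := Order.POrder.on (interval_space K).
HB.instance Definition _ := @isSubBaseTopological.Build
  (interval_space K) (set K) interval_subbase id.

Record compact_tree : Prop := CompactTree {
  compact_tree_tree : is_tree;
  compact_tree_compact : compact [set: interval_space K];
  compact_tree_hausdorff : hausdorff_space (interval_space K) }.

Definition Lambda (kappa : Type) : set (interval_space K) :=
  [set x | exists2 B, is_character x B & [set: kappa] #<= B].

End tree.

Arguments Lambda {d} K kappa.

Section supnorm.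
Context {R : realType} {T : Type} (D : set T).
Implicit Types f g : T -> R^o.

Definition bounded_on f := exists M, forall x, D x -> `|f x| <= M.

Definition supnorm f : R := sup [set `|f x| | x in D].

Lemma supnorm_ub f x : bounded_on f -> D x -> `|f x| <= supnorm f.
Proof.
move=> [M fM] Dx; apply: ub_le_sup; last by exists x.
by exists M => _ [y Dy <-]; exact: fM.
Qed.

Lemma supnorm_le f M : 0 <= M -> (forall x, D x -> `|f x| <= M) ->
  supnorm f <= M.
Proof.
move=> M0 fM; have [D0|/set0P[x Dx]] := eqVneq D set0.
  by rewrite /supnorm D0 image_set0 sup0.
by apply: ge_sup; [exists `|f x|, x|move=> _ [y Dy <-]; exact: fM].
Qed.

Lemma supnorm_ge0 f : bounded_on f -> 0 <= supnorm f.
Proof.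
move=> fb; have [D0|/set0P[x Dx]] := eqVneq D set0.
  by rewrite /supnorm D0 image_set0 sup0.
by rewrite (le_trans _ (supnorm_ub fb Dx)).
Qed.

Lemma supnormD f g : bounded_on f -> bounded_on g ->
  supnorm (f + g) <= supnorm f + supnorm g.
Proof.
move=> fb gb; apply: supnorm_le => [|x Dx].
  by rewrite addr_ge0 ?supnorm_ge0.
by rewrite (le_trans (ler_normD _ _))// lerD// supnorm_ub.
Qed.

Lemma bounded_onZ a f : bounded_on f -> bounded_on (a *: f).
Proof.
move=> [M fM]; exists (`|a| * M) => x Dx.
by rewrite /= normrM ler_wpM2l// fM.
Qed.

Lemma supnormZ a f : bounded_on f -> supnorm (a *: f) = `|a| * supnorm f.
Proof.
have le b g : bounded_on g -> supnorm (b *: g) <= `|b| * supnorm g.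
  move=> gb; apply: supnorm_le => [|x Dx].
    by rewrite mulr_ge0 ?supnorm_ge0.
  by rewrite /= normrM ler_wpM2l// supnorm_ub.
move=> fb; apply/le_anti; rewrite le//=.
have [->|a0] := eqVneq a 0.
  by rewrite normr0 mul0r scale0r supnorm_ge0//; exists 0 => x _; rewrite normr0.
rewrite mulrC -ler_pdivlMr ?normr_gt0// mulrC -normfV.
rewrite -{1}(scale1r f) -(mulVf a0) -scalerA le//.
exact: bounded_onZ.
Qed.

Lemma supnorm_eq0 f : bounded_on f -> supnorm f = 0 ->
  forall x, D x -> f x = 0.
Proof.
by move=> fb f0 x Dx; apply/normr0_eq0/le_anti; rewrite normr_ge0 -f0 supnorm_ub.
Qed.

End supnorm.

(* [C(K)] with the supremum norm; the compactness proof parameterizes the type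
   because it is what makes this norm finite. *)
Section contfun.
Context (R : realType) (K : topologicalType) (cK : compact [set: K]).

Definition contfun_pred : {pred K -> R^o} := mem [set f : K -> R^o | continuous f].

Lemma contfun_submod_closed : submod_closed contfun_pred.
Proof.
split; first by rewrite inE/= => x; exact: cst_continuous.
move=> a f g; rewrite !inE/= => fc gc x.
by apply: cvgD; [apply: cvgZr; exact: fc|exact: gc].
Qed.
HB.instance Definition _ := GRing.isSubmodClosed.Build R (K -> R^o) contfun_pred
  contfun_submod_closed.

Record contfun (c : compact [set: K]) := ContFun {
  contfun_val :> K -> R^o; contfunP : contfun_val \in contfun_pred }.

Notation CK := (contfun cK).

HB.instance Definition _ := [isSub for @contfun_val cK].
HB.instance Definition _ := [Choice of CK by <:].
HB.instance Definition _ := [SubChoice_isSubLmodule of CK by <:].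

Lemma contfun_continuous (f : CK) : continuous f.
Proof. exact: set_mem (contfunP f). Qed.

Lemma contfun_bounded (f : CK) : bounded_on setT f.
Proof.
have /compact_bounded[M [_ Mf]] : compact [set f x | x in [set: K]].
  apply: continuous_compact => //; apply: continuous_subspaceT.
  exact: contfun_continuous.
by exists (M + 1) => x _; apply: Mf; [rewrite ltrDl|exists x].
Qed.

Let norm (f : CK) : R := supnorm setT f.

Let normD (f g : CK) : norm (f + g) <= norm f + norm g.
Proof. by apply: supnormD; exact: contfun_bounded. Qed.

Let normZ a (f : CK) : norm (a *: f) = `|a| * norm f.
Proof. by apply: supnormZ; exact: contfun_bounded. Qed.

Let norm_eq0 (f : CK) : norm f = 0 -> f = 0.
Proof.
move=> /(supnorm_eq0 (contfun_bounded f)) f0.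
by apply/val_inj/funext => x; exact: f0.
Qed.

HB.instance Definition _ := Lmodule_isNormed.Build R CK normD normZ norm_eq0.

Lemma contfun_norm_le (f : CK) M : 0 <= M -> (forall x, `|f x| <= M) -> `|f| <= M.
Proof. by move=> M0 fM; exact: supnorm_le. Qed.

Lemma contfun_le_norm (f : CK) x : `|f x| <= `|f|.
Proof. by apply: supnorm_ub => //; exact: contfun_bounded. Qed.

Lemma contfun_complete (F : set_system CK) : ProperFilter F -> cauchy F -> cvg F.
Proof.
move=> FF /cauchyP Fc.
have evcvg x : cvg ((fun f : CK => f x) @ F).
  apply: cauchy_cvg; apply/cauchy_exP => e e0; have [f Ff] := Fc e e0.
  exists (f x); apply: (@filterS _ F _ (ball f e) _ _ Ff) => g.
  rewrite /preimage/= -!ball_normE/=; apply: le_lt_trans.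
  exact: (contfun_le_norm (f - g)).
pose h (x : K) : R^o := lim ((fun f : CK => f x) @ F).
have hF e f : F (ball f e) -> forall x, `|h x - f x| <= e.
  move=> Ff x; apply/ler_addgt0Pr => r r0.
  have : F [set g : CK | `|h x - g x| < r /\ ball f e g].
    apply: filterI => //.
    by move/cvgrPdist_lt : (evcvg x) => /(_ _ r0).
  move=> /filter_ex[g [hg]]; rewrite -ball_normE/= => fg.
  rewrite -(subrKA (g x)) (le_trans (ler_normD _ _))// addrC lerD ?(ltW hg)//.
  by rewrite distrC (le_trans _ (ltW fg))// (contfun_le_norm (f - g)).
have hc : continuous h.
  move=> x; apply/cvgrPdist_le => e e0.
  have e3 : 0 < e / 3 by rewrite divr_gt0.
  have [f /hF hf] := Fc _ e3.
  have /cvgrPdist_le/(_ _ e3) := @contfun_continuous f x.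
  apply: filterS => y fy.
  rewrite -(subrKA (f x)) -[f x - h y](subrKA (f y)).
  rewrite (le_trans (ler_normD _ _))// [leRHS](_ : _ = e / 3 + (e / 3 + e / 3)).
    rewrite lerD// (le_trans (ler_normD _ _))// lerD//.
    by rewrite distrC.
  by field.
apply/cvg_ex; exists (ContFun cK (mem_set hc)); apply/cvgrPdist_le => e e0.
have e2 : 0 < e / 2 by rewrite divr_gt0.
have [f Ff] := Fc _ e2; apply: filterS (Ff) => g; rewrite -ball_normE/= => fg.
apply: contfun_norm_le => [|x]; first exact: ltW.
rewrite -[X in `|X|]/(h x - g x) -(subrKA (f x)) (le_trans (ler_normD _ _))// (splitr e) lerD//.
  exact: hF.
by rewrite (le_trans _ (ltW fg))// (contfun_le_norm (f - g)).
Qed.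

HB.instance Definition _ := Uniform_isComplete.Build CK contfun_complete.

End contfun.

Section dual.
Context (R : realType) (X : normedModType R).

Definition dual_pred : {pred X -> R^o} :=
  mem [set f : X -> R^o | linear f /\ continuous f].

Lemma dual_submod_closed : submod_closed dual_pred.
Proof.
split; first rewrite inE/=; first split.
- by move=> a u v; rewrite /= scaler0 addr0.
- by move=> x; exact: cst_continuous.
move=> a f g; rewrite !inE/= => -[fl fc] [gl gc]; split.
  move=> b u v; rewrite -[LHS]/(a *: f (b *: u + v) + g (b *: u + v)).
  rewrite -[RHS]/(b *: (a *: f u + g u) + (a *: f v + g v)).
  rewrite fl gl !scalerDr !scalerA [b * a]mulrC.
  by rewrite [in LHS]addrACA.
move=> x; apply: cvgD; [apply: cvgZr; exact: fc|exact: gc].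
Qed.
HB.instance Definition _ := GRing.isSubmodClosed.Build R (X -> R^o) dual_pred
  dual_submod_closed.

Record dual := Dual { dual_val :> X -> R^o; dualP : dual_val \in dual_pred }.

HB.instance Definition _ := [isSub for dual_val].
HB.instance Definition _ := [Choice of dual by <:].
HB.instance Definition _ := [SubChoice_isSubLmodule of dual by <:].

Lemma dual_linear (f : dual) : linear f.
Proof. by have [] := set_mem (dualP f). Qed.

HB.instance Definition _ (f : dual) :=
  GRing.isLinear.Build R X R^o *:%R f (dual_linear f).

Lemma dual_continuous (f : dual) : continuous f.
Proof. by have [] := set_mem (dualP f). Qed.

Let unit_ball : set X := [set x | `|x| <= 1].

Let dual_bounded (f : dual) : bounded_on unit_ball f.
Proof.
have /linear_boundedP/pinfty_ex_gt0[M M0 fM] := continuous_linear_bounded 0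
  (@dual_continuous f 0).
exists M => x x1; rewrite (le_trans (fM x))// -[leRHS]mulr1.
by rewrite ler_wpM2l// ltW.
Qed.

Let norm (f : dual) : R := supnorm unit_ball f.

Let normD (f g : dual) : norm (f + g) <= norm f + norm g.
Proof. by apply: supnormD; exact: dual_bounded. Qed.

Let normZ a (f : dual) : norm (a *: f) = `|a| * norm f.
Proof. by apply: supnormZ; exact: dual_bounded. Qed.

Let norm_le (f : dual) x : `|f x| <= norm f * `|x|.
Proof.
have [->|x0] := eqVneq x 0; first by rewrite linear0 !normr0 mulr0.
have xx : unit_ball (`|x|^-1 *: x).
  by rewrite /unit_ball/= normrZ normfV normr_id mulVf ?normr_eq0.
have := supnorm_ub (dual_bounded f) xx.
by rewrite linearZ/= normrM normfV normr_id mulrC ler_pdivrMr ?normr_gt0.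
Qed.

Let norm_eq0 (f : dual) : norm f = 0 -> f = 0.
Proof.
move=> f0; apply/val_inj/funext => x; apply/normr0_eq0/le_anti.
by rewrite normr_ge0 (le_trans (norm_le f x))// f0 mul0r.
Qed.

HB.instance Definition _ := Lmodule_isNormed.Build R dual normD normZ norm_eq0.

Lemma dual_le_norm (f : dual) x : `|f x| <= `|f| * `|x|.
Proof. exact: norm_le. Qed.

Lemma dual_norm_le (f : dual) M : 0 <= M -> (forall x, `|f x| <= M * `|x|) ->
  `|f| <= M.
Proof.
move=> M0 fM; apply: supnorm_le => // x x1; rewrite (le_trans (fM x))//.
by rewrite -[leRHS]mulr1 ler_wpM2l.
Qed.

Lemma dual_predP (f : X -> R^o) M : linear f -> (forall x, `|f x| <= M * `|x|) ->
  f \in dual_pred.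
Proof.
move=> fl fM; rewrite inE/=; split=> //.
pose F := GRing.isLinear.Build R X R^o *:%R f fl.
pose f' : {linear X -> R^o} := HB.pack f F.
apply: (@bounded_linear_continuous _ _ _ f'); apply/linear_boundedP.
near=> r => x; rewrite (le_trans (fM x))// ler_wpM2r//.
by near: r; apply: nbhs_pinfty_ge; rewrite num_real.
Unshelve. all: by end_near. Qed.

End dual.

Section hahn_banach.
Context (R : realType) (X : normedModType R).
Implicit Types (p q : X * R^o) (G H : set (X * R^o)).

Let good H := (forall a p q, H p -> H q -> H (a *: p + q)) /\
  (forall p, H p -> p.2 <= `|p.1|).

Lemma hahn_banach (x0 : X) : exists2 f : dual X, f x0 = `|x0| & `|f| <= 1.
Proof.
pose G0 : set (X * R^o) := [set (t *: x0, t *: (`|x0| : R^o)) | t in [set: R]].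
have goodG0 : good G0.
  split=> [a _ _ [t _ <-] [u _ <-]|_ [t _ <-]/=]; last first.
    by rewrite normrZ ler_wpM2r// ler_norm.
  exists (a * t + u) => //; congr pair => /=; rewrite scalerDl scalerA//.
have [F FP Ftot|A [[Alin Ale] Amax]] := @Zorn_bigcup _ [set A | good (G0 `|` A)].
  rewrite /=; split.
    move=> a p q Hp Hq.
    have [B [GB Bp Bq BF]] : exists B, [/\ good (G0 `|` B), (G0 `|` B) p,
        (G0 `|` B) q & B `<=` \bigcup_(X in F) X].
      case: Hp Hq => [Gp|[B FB Bp]] [Gq|[C FC Cq]].
      - by exists set0; split=> //; rewrite ?setU0.
      - exists C; split; [exact: FP|by left|by right|exact: bigcup_sup].
      - exists B; split; [exact: FP|by right|by left|exact: bigcup_sup].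
      - have [BC|CB] := Ftot _ _ FB FC.
          exists C; split; [exact: FP|right; exact: BC|by right|exact: bigcup_sup].
        exists B; split; [exact: FP|by right|right; exact: CB|exact: bigcup_sup].
    by have [/(_ a _ _ Bp Bq)[|/BF]] := GB; [left|right].
  move=> p [Gp|[B FB Bp]]; first exact: goodG0.2.
  by apply: (FP _ FB).2; right.
set H := G0 `|` A in Alin Ale.
have H0 : H 0.
  by left; exists 0 => //; rewrite !scale0r.
have HZ a p : H p -> H (a *: p) by move=> Hp; rewrite -[_ *: _]addr0; exact: Alin.
have HD p q : H p -> H q -> H (p + q).
  by move=> Hp Hq; rewrite -[p]scale1r; exact: Alin.
have Htot v : exists r, H (v, r).
  apply: contrapT => Hv.
  pose E := [set p.2 - `|p.1 - v| | p in H].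
  pose a : R^o := sup E.
  have key p q : H p -> H q -> p.2 - `|p.1 - v| <= `|q.1 + v| - q.2.
    move=> Hp Hq; rewrite lerBrDr addrAC lerBlDr.
    rewrite (le_trans (Ale _ (HD _ _ Hp Hq)))//=.
    rewrite (_ : p.1 + q.1 = (q.1 + v) + (p.1 - v)) ?ler_normD//.
    by rewrite [RHS]addrACA subrr addr0 addrC.
  have E0 : E !=set0 by exists (0 - `|0 - v|), 0.
  have Eub q : H q -> ubound E (`|q.1 + v| - q.2).
    by move=> Hq _ [p Hp <-]; exact: key.
  have Esup : has_sup E by split=> //; exists (`|0 + v| - 0); exact: Eub H0.
  have a_le q : H q -> a <= `|q.1 + v| - q.2.
    by move=> Hq; apply: ge_sup => //; exact: Eub.
  have a_ge p : H p -> p.2 - `|p.1 - v| <= a.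
    by move=> Hp; apply: ub_le_sup; [exact: Esup.2|exists p].
  pose H' : set (X * R^o) :=
    [set w | exists p t, H p /\ w = (p.1 + t *: v, p.2 + t *: a)].
  have HH' : H `<=` H'.
    by move=> p Hp; exists p, 0; rewrite !scale0r !addr0; case: p Hp.
  have H'v : H' (v, a) by exists 0, 1; rewrite !scale1r !add0r.
  apply: (Amax H').
    split; first by move=> p Ap; apply: HH'; right.
    by move=> /(_ _ H'v) Av; apply: Hv; exists a; right.
  rewrite /= (_ : G0 `|` H' = H'); last first.
    by apply/setUidPr => p Gp; apply: HH'; left.
  split=> [b _ _ [p [t [Hp ->]]] [q [u [Hq ->]]]|_ [p [t [Hp ->]]]/=].
    exists (b *: p + q), (b * t + u); split; first exact: Alin.
    congr pair => /=; rewrite scalerDr scalerDl scalerA addrACA//.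
  have [t0|t0|->] := ltrgtP t 0; last by rewrite !scale0r !addr0 Ale.
  - have nt0 : 0 < - t by rewrite oppr_gt0.
    have -> : `|p.1 + t *: v| = - t * `|(- t)^-1 *: p.1 - v|.
      rewrite -[X in X * _](gtr0_norm nt0) -normrZ scalerBr scalerA.
      by rewrite mulfV ?gt_eqF// scale1r scaleNr opprK.
    have := ler_wpM2l (ltW nt0) (a_ge _ (HZ (- t)^-1 _ Hp)).
    rewrite /= mulrBr -[_ *: p.2]/((- t)^-1 * p.2) mulrA mulfV ?gt_eqF// mul1r.
    by rewrite -[t *: a]/(t * a) => h; lra.
  - have -> : `|p.1 + t *: v| = t * `|t^-1 *: p.1 + v|.
      rewrite -[X in X * _](gtr0_norm t0) -normrZ scalerDr scalerA.
      by rewrite mulfV ?gt_eqF// scale1r.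
    have := ler_wpM2l (ltW t0) (a_le _ (HZ t^-1 _ Hp)).
    rewrite /= mulrBr -[_ *: p.2]/(t^-1 * p.2) mulrA mulfV ?gt_eqF// mul1r.
    by rewrite -[t *: a]/(t * a) => h; lra.
have Huniq v r r' : H (v, r) -> H (v, r') -> r = r'.
  suff le s s' : H (v, s) -> H (v, s') -> s <= s'.
    by move=> h h'; apply/le_anti; rewrite !le.
  move=> h h'; have /Ale := HD _ _ h (HZ (- 1) _ h').
  by rewrite /= !scaleN1r subrr normr0 subr_le0.
have [f Hf] := choice Htot.
have flin : linear f.
  move=> a u v; apply: (Huniq (a *: u + v)); first exact: Hf.
  exact: (Alin a _ _ (Hf u) (Hf v)).
have f_le v : `|f v| <= 1 * `|v|.
  rewrite mul1r ler_norml; apply/andP; split; last exact: (Ale _ (Hf v)).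
  by have /Ale := HZ (- 1) _ (Hf v); rewrite /= !scaleN1r normrN lerNl.
exists (Dual (dual_predP flin f_le)); last exact: dual_norm_le.
apply: (Huniq x0); first exact: Hf.
by left; exists 1 => //; rewrite !scale1r.
Qed.

End hahn_banach.

Section bidual.
Context (R : realType) (X : normedModType R).
Local Notation bidual := (dual (dual X)).

Definition eval_at (x : X) : dual X -> R^o := fun f => f x.

Lemma eval_at_dual x : eval_at x \in @dual_pred R (dual X).
Proof.
apply: (@dual_predP _ _ _ `|x|) => // f.
by rewrite mulrC; exact: dual_le_norm.
Qed.

(* The canonical embedding of [X] into [X^**]. *)
Definition bidual_embed (x : X) : bidual := Dual (eval_at_dual x).

Lemma bidual_embed_linear : linear bidual_embed.
Proof.
move=> a x y; apply/val_inj/funext => f /=.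
exact: linearP.
Qed.

HB.instance Definition _ :=
  GRing.isLinear.Build R X bidual *:%R bidual_embed bidual_embed_linear.

Lemma bidual_embed_norm x : `|bidual_embed x| = `|x|.
Proof.
apply/le_anti/andP; split.
  by apply: dual_norm_le => // f; rewrite mulrC; exact: (dual_le_norm f x).
have [f <- f1] := hahn_banach x.
rewrite (le_trans (ler_norm _))// (le_trans (dual_le_norm (bidual_embed x) f))//.
by rewrite -[leRHS]mulr1 ler_wpM2l.
Qed.

End bidual.

Section subspace.
Context (R : realType) (V : normedModType R) (W : submodClosed V).

Record subspace := Subspace { subspace_val :> V; subspaceP : subspace_val \in W }.

HB.instance Definition _ := [isSub for subspace_val].
HB.instance Definition _ := [Choice of subspace by <:].
HB.instance Definition _ := [SubChoice_isSubLmodule of subspace by <:].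

Let norm (x : subspace) : R := `|val x|.

Let normD x y : norm (x + y) <= norm x + norm y.
Proof. by rewrite /norm raddfD; exact: ler_normD. Qed.

Let normZ a x : norm (a *: x) = `|a| * norm x.
Proof. by rewrite /norm linearZ; exact: normrZ. Qed.

Let norm_eq0 x : norm x = 0 -> x = 0.
Proof. by move=> /normr0_eq0 x0; apply: val_inj; rewrite x0 raddf0. Qed.

HB.instance Definition _ :=
  Lmodule_isNormed.Build R subspace normD normZ norm_eq0.

End subspace.

(* The quotient [V / W] with the quotient norm; the closedness proof
   parameterizes the type because it is what makes this seminorm a norm. *)
Section quotient.
Context (R : realType) (V : normedModType R) (W : submodClosed V).
Context (cW : closed [set` W]).
Local Open Scope quotient_scope.

Let W_zmod : zmod_closed W.
Proof. exact: GRing.submod_closedB (submodClosedP W). Qed.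

Definition quotient_pred : zmodClosed V :=
  HB.pack (GRing.SubmodClosed.sort W)
    (GRing.isZmodClosed.Build V (GRing.SubmodClosed.sort W) W_zmod).

Definition quotient (c : closed [set` W]) : Type := Quotient.quot quotient_pred.

Local Notation Q := (quotient cW).

HB.instance Definition _ := GRing.Zmodule.on Q.
HB.instance Definition _ := EqQuotient.on Q.

Implicit Types (q r : Q) (v w : V).

Lemma eq_quotientP v w : reflect (\pi_Q v = \pi_Q w) (v - w \in W).
Proof.
rewrite (_ : (v - w \in W) = (v == w %[mod Q])); first exact: eqP.
exact: (Quotient.idealrBE quotient_pred).
Qed.

Let piD v w : \pi_Q (v + w) = \pi_Q v + \pi_Q w.
Proof. exact: (Quotient.pi_add quotient_pred). Qed.

Definition quotient_scale (a : R) q : Q := \pi_Q (a *: repr q).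

Let piZ a v : \pi_Q (a *: v) = quotient_scale a (\pi_Q v).
Proof.
by apply/eq_quotientP; rewrite -scalerBr rpredZ//; apply/eq_quotientP; rewrite reprK.
Qed.

Let scaleA a b q : quotient_scale a (quotient_scale b q) = quotient_scale (a * b) q.
Proof. by rewrite /quotient_scale -/(quotient_scale _ _) -piZ scalerA. Qed.

Let scale1 : left_id 1 quotient_scale.
Proof. by move=> q; rewrite /quotient_scale scale1r reprK. Qed.

Let scaleDr : right_distributive quotient_scale +%R.
Proof.
move=> a q r; rewrite -[q]reprK -[r]reprK -piD -!piZ.
by rewrite scalerDr piD.
Qed.

Let scaleDl q : {morph quotient_scale^~ q : a b / a + b}.
Proof. by move=> a b; rewrite /quotient_scale scalerDl piD. Qed.

HB.instance Definition _ :=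
  GRing.Zmodule_isLmodule.Build R Q scaleA scale1 scaleDr scaleDl.

Definition quotient_proj : V -> Q := \pi_Q.

Lemma quotient_proj_linear : linear quotient_proj.
Proof. by move=> a v w; rewrite /quotient_proj piD piZ. Qed.

HB.instance Definition _ :=
  GRing.isLinear.Build R V Q *:%R quotient_proj quotient_proj_linear.

Lemma quotient_proj_surj q : exists v, quotient_proj v = q.
Proof. by exists (repr q); exact: reprK. Qed.

Lemma quotient_proj_eq0 v : (quotient_proj v == 0) = (v \in W).
Proof.
rewrite -(linear0 quotient_proj) -[v in RHS]subr0.
by apply/eqP/idP => /eq_quotientP.
Qed.

Definition quotient_norm q : R := inf [set `|v| | v in quotient_proj @^-1` [set q]].

Let norm_proj v : quotient_norm (quotient_proj v) <= `|v|.
Proof. by apply: ge_inf; [exists 0 => _ [w _ <-]|exists v]. Qed.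

Let norm_lt q e : 0 < e -> exists2 v, quotient_proj v = q & `|v| < quotient_norm q + e.
Proof.
move=> e0; have [_ [v <- <-] ve] : exists2 x,
    [set `|v| | v in quotient_proj @^-1` [set q]] x & x < quotient_norm q + e.
  apply: inf_adherent => //; split; last by exists 0 => _ [w _ <-].
  by have [v vq] := quotient_proj_surj q; exists `|v|, v.
by exists v.
Qed.

Let normD q r : quotient_norm (q + r) <= quotient_norm q + quotient_norm r.
Proof.
apply/ler_addgt0Pr => e e0.
have e2 : 0 < e / 2 by rewrite divr_gt0.
have [v <- ve] := norm_lt q e2; have [w <- we] := norm_lt r e2.
rewrite -linearD (le_trans (norm_proj _))// (le_trans (ler_normD _ _))//.
by rewrite (splitr e) addrACA lerD// ltW.
Qed.

Let norm_ge0 q : 0 <= quotient_norm q.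
Proof.
apply: lb_le_inf => [|_ [v _ <-]//].
by have [v vq] := quotient_proj_surj q; exists `|v|, v.
Qed.

Let normZ a q : quotient_norm (a *: q) = `|a| * quotient_norm q.
Proof.
have norm0 : quotient_norm 0 = 0.
  apply/le_anti; rewrite norm_ge0 andbT -(linear0 quotient_proj).
  by rewrite (le_trans (norm_proj _))// normr0.
have le b r : b != 0 -> quotient_norm (b *: r) <= `|b| * quotient_norm r.
  move=> b0; apply/ler_addgt0Pr => e e0.
  have eb : 0 < e / `|b| by rewrite divr_gt0 ?normr_gt0.
  have [v <- ve] := norm_lt r eb.
  rewrite -linearZ (le_trans (norm_proj _))// normrZ mulrC.
  rewrite -ler_pdivlMr ?normr_gt0// (le_trans (ltW ve))//.
  by rewrite mulrDl mulrAC mulfV ?normr_eq0// mul1r.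
have [->|a0] := eqVneq a 0; first by rewrite scale0r normr0 mul0r norm0.
apply/le_anti; rewrite le//= mulrC -ler_pdivlMr ?normr_gt0// mulrC -normfV.
by rewrite -[q in leLHS](scale1r q) -(mulVf a0) -scalerA le ?invr_eq0.
Qed.

Let norm_eq0 q : quotient_norm q = 0 -> q = 0.
Proof.
have [v <-] := quotient_proj_surj q => q0; apply/eqP; rewrite quotient_proj_eq0.
apply: cW => B /nbhs_normP[e /= e0 eB].
have [w vw] := norm_lt (quotient_proj v) e0; rewrite q0 add0r => we.
exists (v - w); split; last by apply: eB => /=; rewrite opprB addrC subrK.
by apply/eq_quotientP; rewrite /=.
Qed.

HB.instance Definition _ := Lmodule_isNormed.Build R Q normD normZ norm_eq0.

End quotient.

Lemma closed_range_isometry (R : realType) (X : completeNormedModType R)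
    (V : normedModType R) (j : X -> V) :
  (forall x y, `|j x - j y| = `|x - y|) -> closed (range j).
Proof.
move=> jiso v vj.
pose F : set_system X := filter_from [set e : R | 0 < e] (fun e => j @^-1` ball v e).
have FF : ProperFilter F.
  apply: filter_from_proper; first apply: filter_from_filter.
  - by exists 1 => /=.
  - move=> d e d0 e0; exists (Num.min d e); first by rewrite /= lt_min d0.
    move=> x; rewrite /preimage/= -!ball_normE/= lt_min.
    by move=> /andP[].
  - move=> e e0; have [_ [[x _ <-] xe]] := vj _ (nbhsx_ballx v e e0).
    by exists x.
have Fcvg : cvg F.
  apply: cauchy_cvg; apply/cauchy_exP => e e0.
  have e2 : 0 < e / 2 by rewrite divr_gt0.
  have [_ [[x _ <-] xe]] := vj _ (nbhsx_ballx v (e / 2) e2).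
  exists x, (e / 2) => // y; rewrite /preimage/= -!ball_normE/= => ye.
  rewrite -jiso -(subrKA v) (le_lt_trans (ler_normD _ _))// (splitr e) ltrD//.
  by rewrite distrC; rewrite -ball_normE/= in xe.
have /cvg_ex[x Fx'] := Fcvg.
have /cvgrPdist_lt Fx : (id : X -> X) @ F --> x by exact: Fx'.
exists x => //; apply/eqP; rewrite -subr_eq0 -normr_le0; apply/ler_addgt0Pr => e e0.
have e2 : 0 < e / 2 by rewrite divr_gt0.
have Fv : F (j @^-1` ball v (e / 2)) by exists (e / 2).
have [y [yx]] := filter_ex (filterI (Fx _ e2) Fv).
rewrite /preimage/= -ball_normE/= => yv.
rewrite add0r -(subrKA (j y)) (le_trans (ler_normD _ _))// (splitr e).
by rewrite jiso lerD// ?ltW// distrC.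
Qed.

Section Delta_S.
Context (R : realType) (X : completeNormedModType R) (kappa : Type).

Definition Delta0 : set (dual (dual X)) :=
  [set z | forall A : set (dual X), A #< [set: kappa] ->
     exists x : X, forall f, A f -> z f = f x].

Definition Delta_pred : {pred dual (dual X)} := mem (closure Delta0).

Lemma Delta_submod_closed : submod_closed Delta_pred.
Proof.
split; rewrite ?inE/=.
  apply: subset_closure => A _; exists 0 => f _.
  by rewrite linear0.
move=> a y z; rewrite !inE/= => yD zD B aB.
have : \forall p \near (y, z), B (a *: p.1 + p.2).
  have : a *: p.1 + p.2 @[p --> (y, z)] --> a *: y + z.
    by apply: cvgD; [apply: cvgZr; exact: cvg_fst|exact: cvg_snd].
  exact.
move=> [[P Q]/= [yP zQ] PQ].
have [y' [yD' Py']] := yD _ yP; have [z' [zD' Qz']] := zD _ zQ.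
exists (a *: y' + z'); split; last exact: (PQ (y', z')).
move=> A Ak; have [u uA] := yD' A Ak; have [v vA] := zD' A Ak.
exists (a *: u + v) => f Af; by rewrite linearP -[LHS]/(a *: y' f + z' f) uA ?vA.
Qed.
HB.instance Definition _ := GRing.isSubmodClosed.Build R (dual (dual X))
  Delta_pred Delta_submod_closed.

Definition Delta := subspace Delta_pred.

HB.instance Definition _ := NormedModule.on Delta.

Lemma bidual_embed_Delta (x : X) : bidual_embed x \in Delta_pred.
Proof. by rewrite inE; apply: subset_closure => A _; exists x. Qed.

Definition Delta_embed (x : X) : Delta := Subspace (bidual_embed_Delta x).

(* The copy of [X] inside [Delta]. *)
Definition X_in_Delta : {pred Delta} := mem (range Delta_embed).

Lemma X_in_Delta_submod_closed : submod_closed X_in_Delta.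
Proof.
split; rewrite ?inE/=.
  by exists 0 => //; apply: val_inj; rewrite /= linear0.
move=> a y z; rewrite !inE/= => -[u _ <-] [v _ <-].
by exists (a *: u + v) => //; apply: val_inj; rewrite /= linearP.
Qed.
HB.instance Definition _ := GRing.isSubmodClosed.Build R Delta X_in_Delta
  X_in_Delta_submod_closed.

Lemma X_in_Delta_closed : closed [set` X_in_Delta].
Proof.
rewrite (_ : [set` X_in_Delta] = range Delta_embed); last first.
  by apply/seteqP; split=> z /=; rewrite inE.
apply: closed_range_isometry => x y.
rewrite -(bidual_embed_norm (x - y)) linearB.
by rewrite -[LHS]/(`|val (Delta_embed x - Delta_embed y)|) raddfB.
Qed.

Definition S_space := quotient X_in_Delta_closed.
HB.instance Definition _ := NormedModule.on S_space.

End Delta_S.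

Section c0.
Context (R : realType) (Gamma : Type).

Definition c0_pred : {pred Gamma -> R^o} :=
  mem [set f : Gamma -> R^o | forall e, 0 < e -> finite_set [set g | e <= `|f g|]].

Lemma c0_submod_closed : submod_closed c0_pred.
Proof.
split; rewrite ?inE/=.
  move=> e e0; rewrite (_ : [set _ | _] = set0)//.
  by apply/seteqP; split=> // g /=; rewrite normr0 leNgt e0.
move=> a f h; rewrite !inE/= => fc hc e e0.
have d0 : 0 < e / 2 / (`|a| + 1) by rewrite !divr_gt0// ltr_wpDl.
have e2 : 0 < e / 2 by rewrite divr_gt0.
apply: (sub_finite_set (B := [set g | e / 2 / (`|a| + 1) <= `|f g|] `|`
                            [set g | e / 2 <= `|h g|])); last first.
  by rewrite finite_setU; split; [exact: fc|exact: hc].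
move=> g /= eg; apply: contrapT => /not_orP[/negP + /negP].
rewrite -!ltNge ltr_pdivlMr ?ltr_wpDl// => fg hg; move: eg; apply/negP.
rewrite -ltNge (le_lt_trans (ler_normD _ _))// (splitr e) ltrD//.
rewrite (le_lt_trans _ fg)// normrM mulrC ler_wpM2l// lerDl.
by [].
Qed.
HB.instance Definition _ := GRing.isSubmodClosed.Build R (Gamma -> R^o) c0_pred
  c0_submod_closed.

Record c0 := C0 { c0_val :> Gamma -> R^o; c0P : c0_val \in c0_pred }.

HB.instance Definition _ := [isSub for c0_val].
HB.instance Definition _ := [Choice of c0 by <:].
HB.instance Definition _ := [SubChoice_isSubLmodule of c0 by <:].

Let c0_bounded (f : c0) : bounded_on setT f.
Proof.
have /(_ 1 ltr01)/(finite_image (fun g => `|f g|))/finite_seqP[s fs] :=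
  set_mem (c0P f).
exists (1 + \sum_(r <- s) `|r|) => g _.
have [fg|fg] := ltP `|f g| 1.
  by rewrite (le_trans (ltW fg))// lerDl sumr_ge0.
have gs : `|f g| \in s by have : [set` s] `|f g| by rewrite -fs; exists g.
by rewrite (big_rem _ gs)/= addrCA normr_id lerDl addr_ge0// sumr_ge0.
Qed.

Let norm (f : c0) : R := supnorm setT f.

Let normD (f g : c0) : norm (f + g) <= norm f + norm g.
Proof. by apply: supnormD; exact: c0_bounded. Qed.

Let normZ a (f : c0) : norm (a *: f) = `|a| * norm f.
Proof. by apply: supnormZ; exact: c0_bounded. Qed.

Let norm_eq0 (f : c0) : norm f = 0 -> f = 0.
Proof.
move=> /(supnorm_eq0 (c0_bounded f)) f0.
by apply/val_inj/funext => x; exact: f0.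
Qed.

HB.instance Definition _ := Lmodule_isNormed.Build R c0 normD normZ norm_eq0.

End c0.

Definition linearly_isomorphic (R : realType) (U V : normedModType R) : Prop :=
  exists (f : {linear U -> V}) (g : {linear V -> U}),
    [/\ cancel f g, cancel g f, continuous f & continuous g].

(* Main.v *)
(* A compact tree [K] is covered by finitely many clopen chains [lower t]. By
   well-founded induction along these chains every functional on [C(K)] depends only
   on the values at countably many points, so an element [z] of [Delta] is determined
   by the function [u t = z (dirac t)], which agrees with a continuous function on
   every set of fewer than [kappa] points up to an arbitrarily small error. Such a [u]
   cannot oscillate along an increasing sequence, hence has a limit at each [t] along
   the punctured neighbourhoods, and the limit is [u t] when [t] is not in [Lambda].
   The jumps [u t - lim u] at the points of [Lambda] form an element of [c0] by
   compactness, and they all vanish exactly when [u] is continuous, i.e. when [z] is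
   in [X]. Conversely, any [h] in [c0(Lambda)], extended by [0], agrees with a
   continuous function of norm at most [|h|] on each set of fewer than [kappa] points,
   and evaluating a functional at such an interpolant on a countable set determining
   it defines a linear right inverse of the jump map. *)
From HB Require Import structures.
Require Import Defs.
From mathcomp Require Import all_boot all_order all_algebra.
From mathcomp Require Import finmap ring lra wochoice.
From mathcomp Require Import all_classical all_reals topology normedtype.

Set Implicit Arguments.
Unset Strict Implicit.
Unset Printing Implicit Defensive.

Import Order.TTheory GRing.Theory Num.Theory.
Import numFieldNormedType.Exports.

Local Open Scope classical_set_scope.
Local Open Scope ring_scope.
Local Open Scope card_scope.

(** * Cardinals *)

(* A maximal set of choice functions whose values are pairwise distinct at every
   member of the family exhausts one member; that member is the smallest. *)
Lemma card_le_least (U : Type) (F : set (set U)) : F !=set0 ->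
  exists2 B, F B & forall B', F B' -> B #<= B'.
Proof.
move=> [B0 FB0].
pose good (M : set (set U -> U)) := (forall m B, M m -> F B -> B (m B)) /\
  (forall m m' B, M m -> M m' -> F B -> m B = m' B -> m = m').
have [G Ggood Gtot|M [[MF Minj] Mmax]] := @Zorn_bigcup _ good.
  split=> [m B [N GN Nm] FB|m m' B [N GN Nm] [N' GN' Nm'] FB mB].
    exact: ((Ggood N GN).1 m B).
  have [NN'|N'N] := Gtot _ _ GN GN'.
    by apply: ((Ggood N' GN').2 _ _ B) => //; exact: NN'.
  by apply: ((Ggood N GN).2 _ _ B) => //; exact: N'N.
have [B FB BM] : exists2 B, F B & B `<=` [set m B | m in M].
  apply: contrapT => nB.
  have ex B : exists u, F B -> B u /\ ~ (exists2 m, M m & m B = u).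
    have [FB|] := pselect (F B); last by have [] : exists u : U, True;
      [apply: contrapT => nU; apply: nB; exists B0 => // u; case: nU; exists u
      |move=> u _ nFB; exists u].
    apply: contrapT => nu; apply: nB; exists B => // u Bu.
    by apply: contrapT => nm; apply: nu; exists u.
  have [m0 m0P] := choice ex.
  apply: (Mmax (M `|` [set m0])).
    split; first by move=> m Mm; left.
    by move=> /(_ m0 (or_intror erefl)) Mm0; have [_] := m0P _ FB0; apply; exists m0.
  split=> [m B [Mm|->] FB|m m' B [Mm|->] [Mm'|->] FB //].
  - exact: (MF m B).
  - by have [] := m0P _ FB.
  - exact: (Minj _ _ B).
  - by move=> mB; have [_ []] := m0P _ FB; exists m.
  - by move=> mB; have [_ []] := m0P _ FB; exists m'.
exists B => // B' FB'.
rewrite (card_le_trans (subset_card_le BM))// (card_le_trans (card_image_le _ _))//.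
have /card_esym/card_eqPle[le _] : (fun m => m B') @` M #= M.
  by apply: inj_card_eq => m m' /set_mem Mm /set_mem Mm'; exact: (Minj _ _ B').
rewrite (card_le_trans le)//; apply: subset_card_le => _ [m Mm <-].
exact: (MF m B').
Qed.

(** Copies of [A] and [B] in the sum type form a family of two sets, and its least member embeds
    into the other. *)
Lemma card_le_total (T U : Type) (A : set T) (B : set U) : (A #<= B) || (B #<= A).
Proof.
have iA : @inl T U @` A #= A by apply: inj_card_eq => x y _ _ [].
have iB : @inr T U @` B #= B by apply: inj_card_eq => x y _ _ [].
have [] := @card_le_least _ [set @inl T U @` A; @inr T U @` B].
  by exists (@inl T U @` A); left.
move=> C [->|->] least; apply/orP.
  left; have := least (@inr T U @` B) (or_intror erefl).
  by rewrite (card_le_eql iA) (card_le_eqr iB).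
right; have := least (@inl T U @` A) (or_introl erefl).
by rewrite (card_le_eqr iA) (card_le_eql iB).
Qed.

Lemma card_ltNge (T U : Type) (A : set T) (B : set U) : (A #< B) = ~~ (B #<= A).
Proof.
rewrite /card_lt card_eq_le negb_and.
by have := card_le_total A B; case: (A #<= B); case: (B #<= A).
Qed.

Lemma card_le_lt_trans (T U V : Type) (A : set T) (B : set U) (C : set V) :
  A #<= B -> B #< C -> A #< C.
Proof. by rewrite !card_ltNge => AB; apply: contra => /card_le_trans; apply. Qed.

Lemma character_exists (T : topologicalType) (x : T) :
  exists B : set (set T), is_character x B.
Proof.
have [] := @card_le_least _ (local_base x).
  exists (open_nbhs x); split=> // U; rewrite nbhsE => -[V xV VU].
  by exists V.
by move=> B xB least; exists B.
Qed.

Lemma card_le_fun (T U : Type) (u0 : U) (A : set T) (B : set U) : A #<= B ->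
  exists2 f : T -> U, (forall x, A x -> B (f x)) & {in A &, injective f}.
Proof.
move=> /card_leP[g].
have ex x : exists u, forall Ax : x \in A, u = val (g (SigSub Ax)).
  have [Ax|nAx] := pselect (x \in A); last by exists u0.
  by exists (val (g (SigSub Ax))) => Ax'; rewrite (bool_irrelevance Ax Ax').
have [f fP] := choice ex; exists f => [x /mem_set Ax|x y Ax Ay].
  by rewrite (fP x Ax); exact: set_valP.
rewrite (fP x Ax) (fP y Ay) => /val_inj gxy.
by have /(congr1 val) := inj (mem_set I) (mem_set I) gxy.
Qed.

Lemma countableU (T : Type) (A B : set T) :
  countable A -> countable B -> countable (A `|` B).
Proof.
by move=> cA cB; rewrite -bigcup2E; apply: bigcup_countable => // -[|[|n]].
Qed.

(** * Sets of cardinality below [kappa] *)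

Section regular.
Context (kappa : Type) (kappaP : uncountable_regular_cardinal kappa).

Lemma countable_small (T : Type) (A : set T) : countable A -> A #< [set: kappa].
Proof.
move=> cA; rewrite card_ltNge; apply/negP => kA; apply: kappaP.2.
exact: sub_countable kA cA.
Qed.

(** If [kappa] injected into the union, labelling each [k] by an index of a member containing its
    image would split [kappa] into fewer than [kappa] fibres, each injecting into a small [F i]. The
    injection [j] moves the index set into [kappa], where regularity is stated. *)
Lemma bigcup_small (T U : Type) (A : set T) (F : T -> set U) :
  A #< [set: kappa] -> (forall i, A i -> F i #< [set: kappa]) ->
  \bigcup_(i in A) F i #< [set: kappa].
Proof.
move=> Ak Fk; rewrite card_ltNge; apply/negP => kU.
have [k0 _] : [set: kappa] !=set0.
  by apply/set0P/eqP => k0; apply: kappaP.1.1; rewrite k0.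
have [u0 Uk0] : \bigcup_(i in A) F i !=set0.
  apply/set0P/eqP => U0; move: kU; rewrite U0 card_le0 => /eqP kk.
  by have : set0 k0 by rewrite -kk.
have [g gU ginj] : exists2 g : kappa -> U, (forall k, (\bigcup_(i in A) F i) (g k)) &
    injective g.
  have [g gU ginj] := card_le_fun u0 kU.
  by exists g => [k|k l]; [exact: gU|apply: ginj; exact: mem_set].
have [a aP] : exists a : kappa -> T, forall k, A (a k) /\ F (a k) (g k).
  have ex k : exists i, A i /\ F i (g k) by have [i] := gU k; exists i.
  by have [a] := choice ex; exists a.
have [j jA] : exists j : T -> kappa, {in A &, injective j}.
  by have /andP[/(card_le_fun k0)[j _ jA] _] := Ak; exists j.
have := kappaP.1.2 (j @` A) (fun k => [set l | j (a l) = k]).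
have -> : \bigcup_(i in j @` A) [set l | j (a l) = i] = setT.
  by apply/seteqP; split=> // l _; exists (j (a l)) => //; exists (a l) => //; exact: (aP l).1.
move=> reg; suff : [set: kappa] #< [set: kappa] by rewrite card_ltNge card_lexx.
apply: reg.
  by apply: card_le_lt_trans Ak; exact: card_image_le.
move=> _ [i Ai <-]; apply: card_le_lt_trans (Fk _ Ai).
have : g @` [set l | j (a l) = j i] #<= F i.
  apply: subset_card_le => _ [l /= jl <-].
  have [Al Fl] := aP l; suff <- : a l = i by [].
  by apply: jA => //; exact: mem_set.
by apply: card_le_trans; rewrite (card_le_eqr (inj_card_eq _))// => x y _ _ /ginj.
Qed.

Lemma setU_small (U : Type) (A B : set U) :
  A #< [set: kappa] -> B #< [set: kappa] -> A `|` B #< [set: kappa].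
Proof.
move=> Ak Bk; rewrite -bigcup2E; apply: bigcup_small; first exact: countable_small.
by move=> [|[|n]] // _; exact: countable_small.
Qed.

Lemma image_small (T U : Type) (A : set T) (f : T -> U) :
  A #< [set: kappa] -> f @` A #< [set: kappa].
Proof. exact/card_le_lt_trans/card_image_le. Qed.

End regular.

(** Near-covering compactness is applied to the filter on finite sets in which every finite set is
    eventually included. *)
Lemma compact_fset_cover (X : topologicalType) (U : X -> set X) :
  compact [set: X] -> (forall x, nbhs x (U x)) ->
  exists D : {fset X}, forall y, exists2 x, x \in D & U x y.
Proof.
move=> /compact_near_coveringP cX xU.
pose F : set_system {fset X} :=
  filter_from setT (fun D : {fset X} => [set E : {fset X} | {subset D <= E}]).
have FF : ProperFilter F.
  apply: filter_from_proper; last by move=> D _; exists D.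
  apply: filter_from_filter; first by exists fset0.
  move=> D E _ _; exists (D `|` E)%fset => // G DEG.
  by split=> x xD; apply: DEG; rewrite inE xD ?orbT.
pose P (D : {fset X}) y := exists2 x, x \in D & U x y.
have : \forall D \near F, setT `<=` P D.
  apply: cX => x _; exists (U x, [set D : {fset X} | x \in D]).
    split=> //=; exists [fset x]%fset => // D xD; apply: xD.
    by rewrite inE.
  by move=> [y D]/= [Uy xD]; exists x.
move=> /filter_ex[D DP].
by exists D => y; exact: DP.
Qed.

(** * The interval topology of a compact tree *)

Section compact_tree.
Context {d : Order.disp_t} {K : porderType d}.
Local Notation T := (interval_space K).
Implicit Types (s t u x y : T) (U V : set T).

Definition lower t : set T := [set x | (x <= t)%O].

Lemma lowerxx t : lower t t. Proof. exact: lexx. Qed.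

Lemma open_subbase U : interval_subbase U -> open U.
Proof.
move=> sU; exists [set U]; last by rewrite bigcup_set1.
by move=> _ ->; exact: finI_from1.
Qed.

Lemma open_oc s t : open [set x : T | (s < x <= t)%O].
Proof. by apply: open_subbase; left; exists s, t. Qed.

Lemma nbhs_oc s t : (s < t)%O -> nbhs t [set x | (s < x <= t)%O].
Proof. by move=> st; apply: open_nbhs_nbhs; split; [exact: open_oc|rewrite /= st lexx]. Qed.

Lemma open_minimal t : minimal_point (t : K) -> open [set t].
Proof. by move=> tm; apply: open_subbase; right; exists t. Qed.

Lemma minimalVlt t : minimal_point (t : K) \/ exists s, (s < t)%O.
Proof.
have [h|h] := pselect (exists s, (s < t)%O); first by right.
by left=> s st; apply: h; exists s.
Qed.

Lemma open_lower t : open (lower t).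
Proof.
rewrite openE => x xt; rewrite /interior; have [xm|[s sx]] := minimalVlt x.
  apply: (@filterS _ _ _ [set x]); first by move=> _ ->.
  by apply: open_nbhs_nbhs; split=> //; exact: open_minimal.
by apply: filterS (nbhs_oc sx) => y /andP[_ yx]; exact: le_trans yx xt.
Qed.

Context (treeK : compact_tree K).

(** Either [x] is already minimal in [E], or [E] meets the well-ordered set of predecessors of [x]
    and the least common element is minimal. *)
Lemma tree_minimal (E : set T) : E !=set0 ->
  exists2 t, E t & forall s, (s < t)%O -> ~ E s.
Proof.
move=> [x Ex]; have [h|h] := pselect (exists2 y, E y & (y < x)%O); last first.
  by exists x => // s sx Es; apply: h; exists s.
have [||m] := @compact_tree_tree _ _ treeK x [pred y | (y < x)%O && `[< E y >]].
- by move=> y /andP[].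
- by have [y Ey yx] := h; exists y; rewrite inE yx; apply/asboolP.
move=> [[/andP[mx /asboolP Em] mmin] _]; exists m => // s sm Es.
suff /le_lt_trans/(_ sm) : (m <= s)%O by rewrite ltxx.
by apply: mmin; rewrite inE; apply/andP; split; [exact: lt_trans mx|exact/asboolP].
Qed.

Lemma tree_ind (P : T -> Prop) :
  (forall t, (forall s, (s < t)%O -> P s) -> P t) -> forall t, P t.
Proof.
move=> Pind t; apply: contrapT => nPt.
have [m nPm mmin] : exists2 t, ~ P t & forall s, (s < t)%O -> ~ ~ P s.
  by apply: tree_minimal; exists t.
by apply: nPm; apply: Pind => s /mmin /contrapT.
Qed.

Lemma tree_total t x y : (x <= t)%O -> (y <= t)%O -> (x <= y)%O || (y <= x)%O.
Proof.
rewrite le_eqVlt => /predU1P[->->|xt]; first by rewrite orbT.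
rewrite le_eqVlt => /predU1P[->|yt]; first by rewrite ltW.
exact: (wo_chainW (@compact_tree_tree _ _ treeK t)).
Qed.

Lemma tree_nle_lt t x y : (x <= t)%O -> (y <= t)%O -> ~ (x <= y)%O -> (y < x)%O.
Proof.
move=> xt yt nxy; have /orP[//|yx] := tree_total xt yt.
by rewrite lt_neqAle yx andbT; apply/eqP => e; apply: nxy; rewrite e.
Qed.

(** Each subbasic set around [t] contains an interval ending at [t]; the points below [t] are
    comparable, so a finite intersection contains the interval with the largest left end. Singletons
    of minimal points do not occur, because [s0 < t]. *)
Lemma nbhs_tree s0 t U : (s0 < t)%O -> nbhs t U ->
  exists s, [/\ (s0 <= s)%O, (s < t)%O & [set x | (s < x <= t)%O] `<=` U].
Proof.
move=> s0t; rewrite nbhsE => -[_ [[B Bsub <-] [V BV Vt]] VU].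
suff [s [s0s st sV]] : exists s,
    [/\ (s0 <= s)%O, (s < t)%O & [set x | (s < x <= t)%O] `<=` V].
  by exists s; split=> // x /sV Vx; apply: VU; exists V.
have {}/Bsub[D Dsub DV] := BV; rewrite -DV in Vt *.
suff [s [s0s st sD]] : exists s, [/\ (s0 <= s)%O, (s < t)%O &
    forall W, W \in enum_fset D -> [set x | (s < x <= t)%O] `<=` W].
  by exists s; split=> // x xs W /sD; apply.
have : forall W, W \in enum_fset D -> exists s,
    [/\ (s0 <= s)%O, (s < t)%O & [set x | (s < x <= t)%O] `<=` W].
  move=> W WD; have := Dsub _ WD; rewrite inE => -[[s [t' We]]|[x xm We]].
    have : W t by exact: Vt.
    rewrite We => /= /andP[st tt'].
    have /orP[le|le] := tree_total (ltW st) (ltW s0t).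
      exists s0; split=> // x /= /andP[s0x xt].
      by rewrite (le_lt_trans le s0x) (le_trans xt tt').
    exists s; split=> // x /= /andP[sx xt].
    by rewrite sx (le_trans xt tt').
  by have : W t by [exact: Vt]; rewrite We => /= tx; have := xm s0; rewrite -tx => /(_ s0t).
elim: (enum_fset D) => [_|W E IH WD]; first by exists s0; split.
have [|s [s0s st sD]] := IH; first by move=> W1 ?; apply: WD; rewrite in_cons orbC; apply/orP; left.
have [|s' [s0s' st' sW]] := WD W; first by rewrite in_cons eqxx.
have /orP[le|le] := tree_total (ltW st) (ltW st').
  exists s'; split=> // W1; rewrite in_cons => /predU1P[->//|W1E] x /= /andP[sx xt].
  by apply: (sD _ W1E); rewrite /= xt (le_lt_trans le sx).
exists s; split=> // W1; rewrite in_cons => /predU1P[->|/sD//] x /= /andP[sx xt].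
by apply: sW; rewrite /= xt (le_lt_trans le sx).
Qed.

(* A point [x] of the closure of [lower t] outside [lower t] has all its
   predecessors below [t], and cannot be separated from the least [y <= t] lying
   above them all. *)
Lemma closed_lower t : closed (lower t).
Proof.
move=> x xcl; apply: contrapT => nxt.
have [xm|[s0 s0x]] := minimalVlt x.
  have [y [/= yt yx]] := xcl _ (open_nbhs_nbhs (conj (open_minimal xm) (erefl x))).
  by apply: nxt; rewrite -yx.
have meet s : (s < x)%O -> exists2 y, (s < y < x)%O & (y <= t)%O.
  move=> sx; have [y [/= yt /andP[sy yx]]] := xcl _ (nbhs_oc sx).
  exists y => //; rewrite sy lt_neqAle yx andbT; apply/eqP => e.
  by apply: nxt; rewrite -e.
have [m [mt xm] mmin] : exists2 m, (m <= t)%O /\ (forall s, (s < x)%O -> (s < m)%O) &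
    forall u, (u < m)%O -> ~ ((u <= t)%O /\ forall s, (s < x)%O -> (s < u)%O).
  apply: tree_minimal; exists t; split=> // s /meet[y /andP[sy _] yt].
  exact: lt_le_trans sy yt.
suff xm' : x = m by apply: nxt; rewrite xm'.
apply: (compact_tree_hausdorff treeK) => U V xU mV.
have [s [_ sx sU]] := nbhs_tree s0x xU.
have [s' [_ s'm s'V]] := nbhs_tree (xm _ s0x) mV.
(* By minimality of [m], some predecessor [s1] of [x] is not below [s']. A point of [lower t] below
   [x] and above both [s] and [s1] then lies in [U] and in [V]. *)
have [s1 s1x s's1] : exists2 s1, (s1 < x)%O & (s' <= s1)%O.
  have s't : (s' <= t)%O by rewrite (le_trans _ mt)// ltW.
  apply: contrapT => h; apply: (mmin _ s'm); split=> // u ux.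
  apply: (tree_nle_lt s't) => [|s'u]; last by apply: h; exists u.
  by rewrite (le_trans _ mt)// ltW// xm.
have [y /andP[sy yx] yt] : exists2 y, (s < y < x)%O && (s1 < y)%O & (y <= t)%O.
  have /orP[le|le] := tree_total (ltW sx) (ltW s1x).
    have [y /andP[s1y yx] yt] := meet _ s1x; exists y => //.
    by rewrite s1y yx (le_lt_trans le).
  have [y /andP[s1y yx] yt] := meet _ sx; exists y => //.
  by rewrite s1y yx (le_lt_trans le).
move/andP: sy => [sy y_x]; exists y; split; first by apply: sU; rewrite /= sy ltW.
by apply: s'V; rewrite /= (le_lt_trans s's1 yx) ltW// xm.
Qed.

Lemma clopen_lower t : clopen (lower t).
Proof. by split; [exact: open_lower|exact: closed_lower]. Qed.

Lemma lower_setD s t : (s <= t)%O ->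
  lower t `\` lower s = [set x | (s < x <= t)%O].
Proof.
move=> st; apply/seteqP; split=> x /=; rewrite /lower/=.
  by move=> [xt /(tree_nle_lt xt st) ->].
move=> /andP[sx xt]; split=> // /(lt_le_trans sx).
by rewrite ltxx.
Qed.

Lemma clopen_oc s t : (s <= t)%O -> clopen [set x : T | (s < x <= t)%O].
Proof.
move=> st; rewrite -lower_setD//; rewrite setDE.
by apply: clopenI; [|apply: (@clopenC _ _ set0)]; exact: clopen_lower.
Qed.

(** Compactness gives a cluster point [t]. Since [lower t] is open, the sequence stays below [t],
    and by monotonicity it remains in any [(s, t]] once it has entered it. *)
Lemma increasing_cvg (u : nat -> T) : (forall n, (u n < u n.+1)%O) ->
  exists t, u @ \oo --> t.
Proof.
move=> ui.
have um n m : (n <= m)%N -> (u n <= u m)%O.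
  move=> /subnK <-; elim: (m - n)%N => [|k IH]; first exact: lexx.
  by rewrite addSn (le_trans IH)// ltW.
have [|t [_ tcl]] := compact_tree_compact treeK (F := u @ \oo).
  exact: filterT.
have cl U : nbhs t U -> forall n, exists2 m, (n <= m)%N & U (u m).
  move=> tU n.
  have [_ [[m nm <-] Um]] : ((u @` [set m | (n <= m)%N]) `&` U) !=set0.
    by apply: tcl => //; exists n => // m; exists m.
  by exists m.
have u_le n : (u n <= t)%O.
  have [m nm um_t] := cl _ (open_nbhs_nbhs (conj (open_lower t) (lowerxx t))) n.
  exact: le_trans (um _ _ nm) um_t.
have u_lt n : (u n < t)%O by rewrite (lt_le_trans (ui n)).
exists t => U tU.
have [s [_ st sU]] := nbhs_tree (u_lt 0%N) tU.
have [m _ /andP[sum _]] := cl _ (nbhs_oc st) 0%N.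
exists m => // n /= mn; apply: sU.
by rewrite /= u_le andbT (lt_le_trans sum)// um.
Qed.

Lemma tree_finite_cover : exists D : {fset T}, forall x, exists2 t, t \in D & (x <= t)%O.
Proof.
apply: (compact_fset_cover (U := lower) (compact_tree_compact treeK)) => t.
by apply: open_nbhs_nbhs; split; [exact: open_lower|exact: lowerxx].
Qed.

End compact_tree.

(** * Functionals on C(K) *)

Section contfun_theory.
Context {R : realType} {K : topologicalType} {cK : compact [set: K]}.
Local Notation CK := (contfun R cK).
Implicit Types (f g : CK) (phi : dual CK) (U S : set K).

Lemma contfun_ext f g : (forall x, f x = g x) -> f = g.
Proof. by move=> fg; apply/val_inj/funext. Qed.

Lemma contfun_exists (h : K -> R^o) : continuous h -> exists f : CK, forall x, f x = h x.
Proof. by move=> hc; exists (ContFun cK (mem_set hc)). Qed.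

Lemma contfun_restrict U f : clopen U ->
  exists g : CK, (forall x, U x -> g x = f x) /\ (forall x, ~ U x -> g x = 0).
Proof.
move=> [oU clU]; have [|g gE] := @contfun_exists (fun x => if x \in U then f x else 0).
  move=> x; have [Ux|nUx] := pselect (U x).
    rewrite /continuous_at mem_set//; apply: cvg_trans (@contfun_continuous _ _ _ f x).
    apply: near_eq_cvg; have : nbhs x U by exact: open_nbhs_nbhs.
    by apply: filterS => y Uy; rewrite mem_set.
  rewrite /continuous_at memNset//; apply: cvg_near_cst.
  have : nbhs x (~` U) by apply: open_nbhs_nbhs; split=> //; exact: closed_openC.
  by apply: filterS => y Uy; rewrite memNset.
by exists g; split=> x Ux; rewrite gE; [rewrite mem_set|rewrite memNset].
Qed.

Lemma contfun_truncate f (e : R) : 0 <= e ->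
  exists2 g : CK, `|g| <= e & forall x, `|f x| <= e -> g x = f x.
Proof.
move=> e0; pose m : K -> R^o := (cst (- e) : K -> R^o) \max (f : K -> R^o).
have mc : continuous m.
  by move=> x; apply: continuous_max; [exact: cst_continuous|exact: contfun_continuous].
(* The expression is the minimum of [e] and [m], so [g] is [f] clamped to [[-e, e]]. *)
have [|g gE] := @contfun_exists (fun x => - ((cst (- e) : K -> R^o) \max (- m)) x).
  move=> x; apply: (@continuousN _ _ _ (((cst (- e) : K -> R^o) \max (- m)))).
  by apply: continuous_max; [exact: cst_continuous|apply: continuousN; exact: mc].
have gE' x : g x = - Num.max (- e) (- Num.max (- e) (f x)) by rewrite gE.
exists g => [|x]; last rewrite ler_norml => /andP[ef fe].
  apply: contfun_norm_le => // x; rewrite gE' normrN ler_norml.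
  by rewrite le_max lexx /= ge_max lerNl ge0_cp ?e0//= lerNl le_max lexx.
by rewrite gE' (max_r ef) max_r ?lerN2// opprK.
Qed.

Definition dirac_fun x f : R^o := f x.

Lemma dirac_fun_dual x : dirac_fun x \in @dual_pred R CK.
Proof. by apply: (@dual_predP _ _ _ 1) => // f; rewrite mul1r; exact: contfun_le_norm. Qed.

Definition dirac x : dual CK := Dual (dirac_fun_dual x).

Lemma diracE x f : dirac x f = f x. Proof. by []. Qed.

Lemma dirac_norm x : `|dirac x| <= 1.
Proof. by apply: dual_norm_le => // f; rewrite mul1r; exact: contfun_le_norm. Qed.

Definition determines S phi := forall f, (forall x, S x -> f x = 0) -> phi f = 0.

Lemma determinesS S S' phi : S `<=` S' -> determines S phi -> determines S' phi.
Proof. by move=> SS' Sphi f fS'; apply: Sphi => x /SS' /fS'. Qed.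

Lemma determines_eq S phi f g : determines S phi -> (forall x, S x -> f x = g x) ->
  phi f = phi g.
Proof.
move=> Sphi fg; apply/eqP; rewrite -subr_eq0 -linearB; apply/eqP/Sphi => x Sx.
by rewrite -[LHS]/(f x - g x) fg// subrr.
Qed.

(** Truncating [f] at height [e] leaves its values on [S] unchanged, hence also [phi f]. *)
Lemma determines_le S phi f e : determines S phi -> 0 <= e ->
  (forall x, S x -> `|f x| <= e) -> `|phi f| <= `|phi| * e.
Proof.
move=> Sphi e0 fe; have [g ge gE] := contfun_truncate f e0.
rewrite (determines_eq (g := g) Sphi) => [|x /fe /gE//].
by rewrite (le_trans (dual_le_norm _ _))// ler_wpM2l.
Qed.

Lemma determines_dirac x : determines [set x] (dirac x).
Proof. by move=> f fx; exact: fx. Qed.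

End contfun_theory.

(** * Functionals are determined by countably many points *)

Section compact_tree_dual.
Context {R : realType} {d : Order.disp_t} {K : porderType d} (treeK : compact_tree K).
Local Notation T := (interval_space K).
Local Notation CK := (contfun R (compact_tree_compact treeK)).
Implicit Types (f g h : CK) (phi : dual CK) (s t x : T) (S : set T).

Definition supported (U : set T) f := forall x, ~ U x -> f x = 0.

(* Functions living on [lower s] for some [s < t] are added up disjointly, so the
   supremum [M] of [phi] over their unit ball is almost attained on some
   [lower (s n)] and hence [phi] is small on the functions living above [s n]. *)
Lemma determined_lower phi t :
  (forall s, (s < t)%O -> exists2 S, countable S &
    forall f, supported (lower s) f -> (forall x, S x -> f x = 0) -> phi f = 0) ->
  exists2 S, countable S &
    forall f, supported (lower t) f -> (forall x, S x -> f x = 0) -> phi f = 0.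
Proof.
move=> IH; have [tm|[s0 s0t]] := minimalVlt t.
  exists [set t] => [|f fsupp ft]; first exact: countable1.
  rewrite (_ : f = 0) ?linear0//; apply: contfun_ext => x.
  have [xt|/fsupp->//] := pselect (lower t x).
  have [->|xNt] := eqVneq x t; first exact: ft.
  by have := tm x; rewrite lt_neqAle xNt => /(_ xt).
have exS s : exists S, countable S /\ ((s < t)%O ->
    forall f, supported (lower s) f -> (forall x, S x -> f x = 0) -> phi f = 0).
  have [st|?] := pselect (s < t)%O; last by exists set0.
  by have [S cS phiS] := IH _ st; exists S.
have [S SP] := choice exS.
pose E : set R := [set phi g | g in
  [set g | `|g| <= 1 /\ exists2 s, (s < t)%O & supported (lower s) g]].
have E0 : E !=set0 by exists (phi 0), 0 => //; split; [rewrite normr0|exists s0].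
have Eub : ubound E `|phi|.
  move=> _ [g [g1 _] <-]; rewrite (le_trans (ler_norm _))//.
  by rewrite (le_trans (dual_le_norm _ _))// -[leRHS]mulr1 ler_wpM2l.
have Esup : has_sup E by split=> //; exists `|phi|.
have exs n : exists sg : T * CK, [/\ (sg.1 < t)%O, supported (lower sg.1) sg.2,
    `|sg.2| <= 1 & sup E - n.+1%:R^-1 < phi sg.2].
  have n0 : 0 < n.+1%:R^-1 :> R by rewrite invr_gt0.
  have [_ [g [g1 [s st sg]] <-] lt] := sup_adherent n0 Esup.
  by exists (s, g).
have [sg sgP] := choice exs.
(* The supports of [h] and of the almost extremal function [(sg n).2] are disjoint, so their sum
   stays in the unit ball and [phi] of it is at most [sup E]. *)
have small n s h : ((sg n).1 <= s)%O -> (s < t)%O -> `|h| <= 1 ->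
    supported [set x | ((sg n).1 < x <= s)%O] h -> phi h <= n.+1%:R^-1.
  move=> sgs st h1 hsupp; have [sgt gsupp g1 gE] := sgP n.
  have : phi ((sg n).2 + h) <= sup E.
    apply: ub_le_sup; first exact: Esup.2.
    exists ((sg n).2 + h) => //; split; last first.
      exists s => // x nxs; rewrite -[LHS]/((sg n).2 x + h x) gsupp ?hsupp ?addr0//.
        by move=> /andP[_].
      by move=> /le_trans/(_ sgs).
    apply: contfun_norm_le => // x; rewrite -[X in `|X|]/((sg n).2 x + h x).
    have [xs|/gsupp->] := pselect (lower (sg n).1 x); last first.
      by rewrite add0r (le_trans (contfun_le_norm _ _)).
    rewrite hsupp ?addr0 ?(le_trans (contfun_le_norm _ _))//.
    by move=> /andP[/(le_lt_trans xs)]; rewrite ltxx.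
  rewrite linearD /= => le.
  by rewrite -(lerD2l (phi (sg n).2)) (le_trans le)// -lerBlDr ltW.
(* The point [t] is added so that [f t = 0], which makes [f] small on some [(s, t]]. *)
exists ([set t] `|` \bigcup_n S (sg n).1).
  apply: countableU; first exact: countable1.
  by apply: bigcup_countable => // n _; exact: (SP _).1.
suff small_f f : `|f| <= 1 -> supported (lower t) f ->
    (forall x, ([set t] `|` \bigcup_n S (sg n).1) x -> f x = 0) -> phi f = 0.
  move=> f fsupp fS; have [->|f0] := eqVneq f 0; first by rewrite linear0.
  have /eqP : phi (`|f|^-1 *: f) = 0.
    apply: small_f => [|x /fsupp fx|x /fS fx].
    - by rewrite normrZ normfV normr_id mulVf ?normr_eq0.
    - by rewrite -[LHS]/(`|f|^-1 * f x) fx mulr0.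
    - by rewrite -[LHS]/(`|f|^-1 * f x) fx mulr0.
  by rewrite linearZ mulf_eq0 invr_eq0 normr_eq0 (negbTE f0) => /eqP.
move=> f1 fsupp fS; apply/normr0_eq0/le_anti; rewrite normr_ge0 andbT.
apply/ler_addgt0Pr => e e0; rewrite add0r.
have e2 : 0 < e / 2 by rewrite divr_gt0.
have [n] := ltr_add_invr e2; rewrite add0r => ne.
(* This gives [|phi| * r <= e / 2]; the added [1] keeps the denominator positive. *)
pose r := e / 2 / (`|phi| + 1).
have r0 : 0 < r by rewrite divr_gt0// ltr_wpDl.
have [sgt _ _ _] := sgP n.
have [s [sgs st fr]] : exists s, [/\ ((sg n).1 <= s)%O, (s < t)%O &
    [set x | (s < x <= t)%O] `<=` [set x | `|f x| <= r]].
  apply: (nbhs_tree treeK sgt).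
  have /cvgrPdist_le/(_ _ r0) := @contfun_continuous _ _ _ f t.
  by apply: filterS => x; rewrite fS ?sub0r ?normrN//; left.
(* Three disjoint pieces of [f]: [phi] kills the one on [lower (sg n).1] by the choice of [S], is
   bounded by [small] on the middle one, and is small on the last because [|f| <= r] there. *)
have [f1' [f1E f1N]] := contfun_restrict f (clopen_lower treeK (sg n).1).
have [f2 [f2E f2N]] := contfun_restrict f (clopen_oc treeK sgs).
have [f3 [f3E f3N]] := contfun_restrict f (clopen_oc treeK (ltW st)).
have fE : f = f1' + f2 + f3.
  apply: contfun_ext => x; rewrite -[RHS]/(f1' x + f2 x + f3 x).
  have [xt|nxt] := pselect (lower t x); last first.
    rewrite fsupp// f1N ?f2N ?f3N ?addr0//.
    - by move=> /andP[_].
    - by move=> /andP[_ /le_trans/(_ (ltW st))].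
    - by move=> /le_trans/(_ (ltW sgt)).
  have [xs|nxs] := pselect (lower (sg n).1 x).
    rewrite f1E// f2N ?f3N ?addr0//; move=> /andP[].
      by move=> /(le_lt_trans (le_trans xs sgs)); rewrite ltxx.
    by move=> /(le_lt_trans xs); rewrite ltxx.
  have lts := tree_nle_lt treeK xt (ltW sgt) nxs.
  have [xs|nxs'] := pselect (lower s x).
    rewrite f1N// f2E ?f3N ?addr0 ?add0r//=; last by rewrite lts.
    by move=> /andP[/(le_lt_trans xs)]; rewrite ltxx.
  have lts' := tree_nle_lt treeK xt (ltW st) nxs'.
  rewrite f1N// f2N ?f3E ?addr0 ?add0r//=; first by rewrite lts'.
  by move=> /andP[_].
have f2_1 : `|f2| <= 1.
  apply: contfun_norm_le => // x.
  have [/f2E->|/f2N->] := pselect ([set x | ((sg n).1 < x <= s)%O] x).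
    exact: le_trans (contfun_le_norm _ _) f1.
  by rewrite normr0.
have f3r : `|f3| <= r.
  apply: contfun_norm_le => [|x]; first exact: ltW.
  have [/[dup]/fr fx /f3E->//|/f3N->] := pselect ([set x | (s < x <= t)%O] x).
  by rewrite normr0 ltW.
have phi1 : phi f1' = 0.
  apply: ((SP _).2 sgt) => // x Sx.
  have [/f1E->|/f1N//] := pselect (lower (sg n).1 x).
  by apply: fS; right; exists n.
have phi2 : `|phi f2| <= n.+1%:R^-1.
  rewrite ler_norml lerNl -linearN !(small n s)//.
  - by rewrite normrN.
  - by move=> x /f2N fx; rewrite -[LHS]/(- f2 x) fx oppr0.
have phi3 : `|phi f3| <= e / 2.
  rewrite (le_trans (dual_le_norm _ _))// (le_trans (ler_wpM2l _ f3r))//.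
  rewrite /r mulrCA ler_piMr//; first exact: ltW.
  by rewrite ler_pdivrMr ?ltr_wpDl// mul1r lerDl.
rewrite fE !linearD /= phi1 add0r (le_trans (ler_normD _ _))// (splitr e) lerD//.
by rewrite (le_trans phi2)// ltW.
Qed.

(** Tree induction treats the functions living on one [lower t]. For the general case a finite cover
    by such sets is used, and the restriction of [f] to one member at a time is subtracted. *)
Lemma countably_determined phi : exists2 S, countable S & determines S phi.
Proof.
have /choice[S SP] t : exists S, countable S /\
    forall f, supported (lower t) f -> (forall x, S x -> f x = 0) -> phi f = 0.
  elim/(tree_ind treeK) : t => t IH.
  have [s st|S cS SP] := @determined_lower phi t; last by exists S.
  by have [S []] := IH _ st; exists S.
have [D Dcov] := tree_finite_cover treeK.
exists (\bigcup_(t in [set` D]) S t).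
  by apply: bigcup_countable => [|t _]; [exact: finite_set_countable|exact: (SP t).1].
suff dec (E : seq T) f : {subset E <= D} ->
    supported [set x | exists2 t, t \in E & (x <= t)%O] f ->
    (forall x, (\bigcup_(t in [set` D]) S t) x -> f x = 0) -> phi f = 0.
  move=> f fS; apply: (dec (enum_fset D)) => // x.
  by have [t tD xt] := Dcov x; case; exists t.
elim: E f => [|t E IH] f ED fsupp fS.
  rewrite (_ : f = 0) ?linear0//; apply: contfun_ext => x.
  by apply: fsupp => -[].
have [f1 [f1E f1N]] := contfun_restrict f (clopen_lower treeK t).
have tD : t \in D by apply: ED; rewrite in_cons eqxx.
have -> : f = f1 + (f - f1) by rewrite addrC subrK.
rewrite linearD /= (SP t).2// ?add0r; last first.
  move=> x Sx; have [/f1E->|/f1N//] := pselect (lower t x).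
  by apply: fS; exists t.
apply: IH => [s sE|x xE|x Sx].
- by apply: ED; rewrite in_cons sE orbT.
- rewrite -[LHS]/(f x - f1 x); have [/f1E->|xt] := pselect (lower t x).
    by rewrite subrr.
  rewrite f1N// fsupp ?subrr// => -[s]; rewrite in_cons => /predU1P[->//|sE xs].
  by apply: xE; exists s.
rewrite -[LHS]/(f x - f1 x) fS// sub0r.
by have [/f1E->|/f1N->] := pselect (lower t x); rewrite ?fS ?oppr0.
Qed.

End compact_tree_dual.

(** * Jumps at the points of large character *)

Lemma continuous_dnbhs (X Y : topologicalType) (u : X -> Y) (t : X) :
  u @ t^' --> u t -> {for t, continuous u}.
Proof.
move=> ut U Uut; have : nbhs t [set x | x != t -> U (u x)] by exact: ut.
by apply: filterS => x /= Ux; have [->|/Ux//] := eqVneq x t; exact: nbhs_singleton.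
Qed.

Lemma dnbhsS (X : topologicalType) (t : X) (U V : set X) :
  nbhs t V -> (forall x, V x -> x != t -> U x) -> t^' U.
Proof. by move=> tV VU; apply: filterS tV => x /VU. Qed.

Lemma dnbhs_set1 (X : topologicalType) (t : X) (U : set X) : open [set t] -> t^' U.
Proof.
by move=> ot; apply: (@dnbhsS _ _ _ [set t]) => [|x -> /eqP//]; exact: open_nbhs_nbhs.
Qed.

Section Lambda_theory.
Context {d : Order.disp_t} {K : porderType d} (treeK : compact_tree K).
Context (kappa : Type) (kappaP : uncountable_regular_cardinal kappa).
Local Notation T := (interval_space K).
Implicit Types (s t x : T) (S : set T).

Lemma Lambda_local_base t B : Lambda K kappa t -> local_base t B -> [set: kappa] #<= B.
Proof. by move=> [B0 [_ B0min] kB0] /B0min; exact: card_le_trans. Qed.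

Lemma NLambda_local_base t : ~ Lambda K kappa t ->
  exists2 B, local_base t B & B #< [set: kappa].
Proof.
move=> nL; have [B Bchar] := character_exists t; exists B; first by case: Bchar.
by rewrite card_ltNge; apply/negP => kB; apply: nL; exists B.
Qed.

(** An isolated point has a local base with a single member, so it is not in [Lambda]. *)
Lemma Lambda_proper t : Lambda K kappa t -> ProperFilter t^'.
Proof.
move=> tL; apply: Build_ProperFilter_ex => U tU; apply: contrapT => nU.
have t1 : nbhs t [set t].
  have : nbhs t [set x | x != t -> U x] by [].
  apply: filterS => x /= xU; apply: contrapT => /eqP xt; apply: nU; exists x; exact: xU.
have : local_base t [set [set t]].
  split=> [_ ->|V tV]; last by exists [set t] => // _ ->; exact: nbhs_singleton.
  split=> //; rewrite openE => _ ->; exact: t1.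
move=> /(Lambda_local_base tL) k1; apply: kappaP.2.
apply: sub_countable k1 _; exact: countable1.
Qed.

(** If [S] met every punctured neighbourhood of [t], it would be cofinal below [t], and the
    intervals [(s, t]] with [s] in [S] would form a local base that is too small. *)
Lemma Lambda_gap t S : Lambda K kappa t -> S #< [set: kappa] -> t^' (~` S).
Proof.
move=> tL Sk; apply: contrapT => nS; move: Sk; rewrite card_ltNge => /negP; apply.
have [s0 s0t] : exists s0, (s0 < t)%O.
  have [tm|//] := minimalVlt t; by exfalso; apply: nS; exact/dnbhs_set1/open_minimal.
have : local_base t ((fun s => [set x | (s < x <= t)%O]) @` [set s | S s /\ (s < t)%O]).
  split=> [_ [s [Ss st] <-]|U tU].
    by split; [exact: open_oc|rewrite /= st lexx].
  have [s [_ st sU]] := nbhs_tree treeK s0t tU.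
  have [x [Sx /andP[sx xt]]] : exists x, S x /\ (s < x < t)%O.
    apply: contrapT => nx; apply: nS; apply: dnbhsS (nbhs_oc st) _ => x /andP[sx xt] xNt Sx.
    by apply: nx; exists x; rewrite sx lt_neqAle xNt.
  exists [set y | (x < y <= t)%O]; first by exists x.
  by move=> y /= /andP[xy yt]; apply: sU; rewrite /= yt (lt_trans sx).
move=> /(Lambda_local_base tL) /card_le_trans; apply.
rewrite (card_le_trans (card_image_le _ _))//.
by apply: subset_card_le => x [].
Qed.

End Lambda_theory.

(** * Approximable functions, their punctured limits and their jumps *)

Section jump.
Context {R : realType} {d : Order.disp_t} {K : porderType d} (treeK : compact_tree K).
Context (kappa : Type) (kappaP : uncountable_regular_cardinal kappa).
Local Notation T := (interval_space K).
Local Notation CK := (contfun R (compact_tree_compact treeK)).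
Implicit Types (f : CK) (s t x : T) (S : set T) (u v : T -> R^o) (e : R).

(** This models the values of an element of [Delta] at the Dirac functionals; the error [e] reflects
    the norm closure in [Delta]. *)
Definition approximable u := forall e S, 0 < e -> S #< [set: kappa] ->
  exists f, forall x, S x -> `|u x - f x| <= e.

(** A continuous [f] approximating [u] on the countable range converges along the sequence. The four
    errors are those between [u] and [f] at two consecutive terms and between [f] there and its
    limit. *)
Lemma approximable_increasing u (s : nat -> T) e : approximable u -> 0 < e ->
  (forall n, (s n < s n.+1)%O) -> exists n, `|u (s n) - u (s n.+1)| <= e.
Proof.
move=> uA e0 si; have e4 : 0 < e / 4 by rewrite divr_gt0.
have [f fu] := uA _ (range s) e4
    (image_small s (countable_small kappaP (countableP [set: nat]))).
have [t st] := increasing_cvg treeK si.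
have fst : (f : T -> R^o) \o s @ \oo --> f t.
  by apply: (cvg_comp _ _ st); exact: contfun_continuous.
have /cvgrPdist_le/(_ _ e4)[n _ nP] := fst.
exists n; have := nP n (leqnn n); have := nP n.+1 (leqnSn n) => /=.
have := fu (s n) (ex_intro2 _ _ n I erefl).
have := fu (s n.+1) (ex_intro2 _ _ n.+1 I erefl).
move: (u (s n)) (u (s n.+1)) (f (s n)) (f (s n.+1)) (f t) => a b c e' g.
rewrite !ler_norml => /andP[? ?] /andP[? ?] /andP[? ?] /andP[? ?].
by apply/andP; split; lra.
Qed.

(** Otherwise every point of [[s0, t)] has a later one below [t] where [u] differs by more than [e];
    iterating from [s0] gives an increasing sequence with no small step. *)
Lemma approximable_oscillation u s0 t e : approximable u -> 0 < e -> (s0 < t)%O ->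
  exists s, [/\ (s0 <= s)%O, (s < t)%O & forall x, (s < x < t)%O -> `|u s - u x| <= e].
Proof.
move=> uA e0 s0t; apply: contrapT => osc.
have /choice[next nextP] s : exists x, (s0 <= s)%O -> (s < t)%O ->
    (s < x < t)%O /\ e < `|u s - u x|.
  apply: contrapT => nx; apply: osc; exists s.
  have [s0s|ns] := pselect (s0 <= s)%O; last by exfalso; apply: nx; exists s.
  have [st|ns] := pselect (s < t)%O; last by exfalso; apply: nx; exists s.
  split=> // x sxt; rewrite leNgt; apply/negP => ex; apply: nx; by exists x.
pose s n := iter n next s0.
have sP n : (s0 <= s n)%O && (s n < t)%O.
  elim: n => [|n /andP[s0s st]]; first by rewrite lexx.
  have [/andP[sx xt] _] := nextP _ s0s st.
  by rewrite /= xt (le_trans s0s)// ltW.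
have [n|n] := approximable_increasing (s := s) uA e0.
  by have /andP[s0s st] := sP n; have [/andP[]] := nextP _ s0s st.
by have /andP[s0s st] := sP n; have [_] := nextP _ s0s st; rewrite ltNge => /negbTE ->.
Qed.

(** Small oscillation on the intervals [(s, t)] makes the image of the punctured filter Cauchy. At
    an isolated point this filter is improper and any value, here [0], is a limit. *)
Lemma approximable_cvg u t : approximable u -> cvg (u @ t^').
Proof.
move=> uA; have [t0|t0] := pselect (t^' set0).
  by apply/cvg_ex; exists 0 => U _; apply: filterS t0.
have tP := Build_ProperFilter t0 (dnbhs_filter t).
apply: cauchy_cvg; apply/cauchy_exP => e e0.
have [tm|[s0 s0t]] := minimalVlt t.
  by exfalso; apply: t0; exact/dnbhs_set1/open_minimal.
have e2 : 0 < e / 2 by rewrite divr_gt0.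
have [s [_ st sP]] := approximable_oscillation uA e2 s0t.
exists (u s); apply: dnbhsS (nbhs_oc st) _ => x /andP[sx xt] xNt.
have /sP usx : (s < x < t)%O by rewrite sx lt_neqAle xNt.
by rewrite /ball/= (le_lt_trans usx)// ltr_pdivrMr// mulr_natr mulr2n ltrDl.
Qed.

(** From each member of a local base of fewer than [kappa] sets a point [p V] other than [t] is
    picked. A continuous [f] close to [u] at these points and at [t] forces [u t] to be close to the
    punctured limit [c]. *)
Lemma approximable_NLambda u t : approximable u -> ~ Lambda K kappa t ->
  u @ t^' --> u t.
Proof.
move=> uA tL; have [t0|t0] := pselect (t^' set0).
  by move=> U _; apply: filterS t0.
have tP := Build_ProperFilter t0 (dnbhs_filter t).
have /cvg_ex[c uc] := approximable_cvg (t := t) uA.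
suff -> : u t = c by [].
apply/eqP; rewrite -subr_eq0 -normr_le0; apply/ler_addgt0Pr => e e0; rewrite add0r.
have e4 : 0 < e / 4 by rewrite divr_gt0.
have [B [Bo Bbase] Bk] := NLambda_local_base tL.
have /choice[p pP] V : exists x, B V -> V x /\ x != t.
  have [/Bo BV|?] := pselect (B V); last by exists t.
  have tV : t^' V by apply: nbhs_dnbhs; exact: open_nbhs_nbhs.
  by have [x [Vx xNt]] := filter_ex (filterI tV (nbhs_dnbhs_neq t)); exists x.
have [f fu] := uA _ ([set t] `|` p @` B) e4
  (setU_small kappaP (countable_small kappaP (countable1 t)) (image_small p Bk)).
have [V BV VP] : exists2 V, B V & V `<=` [set x | x != t -> `|c - u x| <= e / 4]
    `&` [set x | `|f t - f x| <= e / 4].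
  apply: Bbase; apply: filterI; first by move/cvgrPdist_le : uc; apply.
  by have /cvgrPdist_le := @contfun_continuous _ _ _ f t; apply.
have [Vp pNt] := pP V BV; have [/(_ pNt) + +] := VP _ Vp => /=.
have := fu t (or_introl erefl); have := fu (p V) (or_intror (ex_intro2 _ _ V BV erefl)).
move: (u t) (u (p V)) (f t) (f (p V)) => a b a' b'.
rewrite !ler_norml => /andP[? ?] /andP[? ?] /andP[? ?] /andP[? ?].
by apply/andP; split; lra.
Qed.

Definition jump u t : R^o := u t - lim (u @ t^').

Lemma cvg_jump u t (c : R^o) : Lambda K kappa t -> u @ t^' --> c -> jump u t = u t - c.
Proof.
move=> tL uc; have tP := Lambda_proper kappaP tL.
by rewrite /jump (cvg_lim _ uc).
Qed.

Lemma jumpP u v t a : approximable u -> approximable v -> Lambda K kappa t ->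
  jump (a *: u + v) t = a *: jump u t + jump v t.
Proof.
move=> uA vA tL.
have /cvg_ex[c uc] := approximable_cvg (t := t) uA.
have /cvg_ex[c' vc] := approximable_cvg (t := t) vA.
rewrite (cvg_jump tL uc) (cvg_jump tL vc) (cvg_jump (c := a *: c + c') tL).
  by rewrite -[LHS]/(a * u t + v t - (a * c + c')) -[RHS]/(a * (u t - c) + (v t - c')); ring.
by apply: cvgD => //; apply: cvgZr.
Qed.

Lemma jump_continuous u t : Lambda K kappa t -> {for t, continuous u} -> jump u t = 0.
Proof.
move=> tL uc; rewrite (@cvg_jump _ _ (u t))// ?subrr//.
exact: cvg_trans (cvg_app _ (@nbhs_dnbhs _ t)) uc.
Qed.

Lemma jump_le u t M : approximable u -> Lambda K kappa t ->
  (forall x, `|u x| <= M) -> `|jump u t| <= M + M.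
Proof.
move=> uA tL uM; have tP := Lambda_proper kappaP tL.
have /cvg_ex[c uc] := approximable_cvg (t := t) uA.
rewrite (cvg_jump tL uc) (le_trans (ler_normB _ _))// lerD//.
apply/ler_addgt0Pr => e e0.
have uce : t^' [set x | `|c - u x| <= e] by move/cvgrPdist_le : uc; apply.
have [x xe] := filter_ex uce.
by rewrite -(subrK (u x) c) addrC (le_trans (ler_normD _ _))// lerD.
Qed.

(** On a punctured neighbourhood of [x], [u] stays within [e / 4] of its limit at [x], so every jump
    there is at most [3 e / 4]. By compactness, finitely many centres [x] carry all jumps of size at
    least [e]. *)
Lemma jump_c0 u : approximable u ->
  (fun t : Lambda K kappa => jump u (val t)) \in @c0_pred R (Lambda K kappa).
Proof.
move=> uA; rewrite inE => e e0; have e4 : 0 < e / 4 by rewrite divr_gt0.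
pose U x : set T := [set y | y != x -> Lambda K kappa y -> `|jump u y| < e].
have [x|D Dcov] := @compact_fset_cover T U (compact_tree_compact treeK).
  have /cvg_ex[c uc] := approximable_cvg (t := x) uA.
  have : x^' [set y | `|c - u y| <= e / 4] by move/cvgrPdist_le : uc; apply.
  rewrite /dnbhs/within/= {1}nbhsE => -[V [oV Vx] VP].
  have xV : nbhs x V by exact: open_nbhs_nbhs.
  apply: filterS xV => y Vy yNx yL.
  have yP := Lambda_proper kappaP yL.
  have /cvg_ex[c' uc'] := approximable_cvg (t := y) uA.
  (* The centre [x] is removed because [u x] itself may be far from [c]. *)
  have yV : nbhs y (V `&` ~` [set x]).
    apply: open_nbhs_nbhs; split; last by split=> //; exact/eqP.
    apply: openI => //; apply: closed_openC; apply: accessible_closed_set1.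
    exact/hausdorff_accessible/(compact_tree_hausdorff treeK).
  have yc' : y^' [set w | `|c' - u w| <= e / 4] by move/cvgrPdist_le : uc'; apply.
  have [w [[Vw wNx] wc']] := filter_ex (filterI (nbhs_dnbhs yV) yc').
  rewrite (cvg_jump yL uc').
  have := VP _ Vw (introN eqP wNx); have := VP _ Vy yNx; move: wc' => /=.
  move: (u y) (u w) => a b.
  rewrite ltr_norml !ler_norml => /andP[? ?] /andP[? ?] /andP[? ?].
  by apply/andP; split; lra.
apply: (@sub_finite_set _ _ (val @^-1` [set` D])).
  move=> t /= et; have [x xD /=] := Dcov (val t).
  have [->//|tNx] := eqVneq (val t) x.
  by move=> /(_ tNx (set_valP t)); rewrite ltNge et.
apply: finite_preimage; last exact: finite_fset.
by move=> x y _ _; exact: val_inj.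
Qed.

Lemma approximable_continuous u : approximable u ->
  (forall t, Lambda K kappa t -> jump u t = 0) -> continuous u.
Proof.
move=> uA u0 t; apply: continuous_dnbhs.
have [tL|tL] := pselect (Lambda K kappa t); last exact: approximable_NLambda.
have /cvg_ex[c uc] := approximable_cvg (t := t) uA.
by have := u0 _ tL; rewrite (cvg_jump tL uc) => /eqP; rewrite subr_eq0 => /eqP ->.
Qed.

End jump.

(** * Norm estimates in [c0], in [Delta] and in quotients *)

Section c0_norm.
Context {R : realType} {Gamma : Type}.
Implicit Type h : c0 R Gamma.

Lemma c0_le_norm h g : `|h g| <= `|h|.
Proof.
have hb : bounded_on setT h.
  have /(_ 1 ltr01)/(finite_image (fun g => `|h g|))/finite_fsetP[s sE] := set_mem (c0P h).
  exists (1 + \sum_(r <- s) `|r|) => x _.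
  have [hx|hx] := ltP `|h x| 1; first by rewrite (le_trans (ltW hx))// lerDl sumr_ge0.
  have xs : `|h x| \in enum_fset s by have : [set` s] `|h x| by rewrite -sE; exists x.
  by rewrite (big_rem _ xs)/= addrCA normr_id lerDl addr_ge0// sumr_ge0.
exact: supnorm_ub hb I.
Qed.

Lemma c0_norm_le h M : 0 <= M -> (forall g, `|h g| <= M) -> `|h| <= M.
Proof. by move=> M0 hM; exact: supnorm_le. Qed.

End c0_norm.

Lemma linear_le_continuous (R : realType) (U V : normedModType R)
    (f : {linear U -> V}) (M : R) :
  (forall x, `|f x| <= M * `|x|) -> continuous f.
Proof.
move=> fM; apply: bounded_linear_continuous; apply/linear_boundedP.
near=> r => x; rewrite (le_trans (fM x))// ler_wpM2r//.
by near: r; apply: nbhs_pinfty_ge; rewrite num_real.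
Unshelve. all: by end_near. Qed.

Lemma Delta_approx (R : realType) (X : completeNormedModType R) (kappa : Type)
    (z : dual (dual X)) (e : R) (A : set (dual X)) :
  z \in Delta_pred kappa -> 0 < e -> A #< [set: kappa] ->
  exists x : X, forall f, A f -> `|z f - f x| <= e * `|f|.
Proof.
rewrite inE => zcl e0 Ak; have [y [yD zy]] := zcl _ (nbhsx_ballx z e e0).
have [x xA] := yD A Ak; exists x => f Af; rewrite -(xA _ Af).
rewrite -[X in `|X|]/((z - y) f) (le_trans (dual_le_norm _ _))// ler_wpM2r//.
by move: zy; rewrite -ball_normE/= => /ltW.
Qed.

Lemma quotient_proj_norm_le (R : realType) (V : normedModType R) (W : submodClosed V)
    (cW : closed [set` W]) (v : V) : `|quotient_proj cW v| <= `|v|.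
Proof. by apply: ge_inf; [exists 0 => _ [w _ <-]|exists v]. Qed.

Lemma le_quotient_norm (R : realType) (V : normedModType R) (W : submodClosed V)
    (cW : closed [set` W]) (q : quotient cW) (M : R) :
  (forall v, quotient_proj cW v = q -> M <= `|v|) -> M <= `|q|.
Proof.
move=> Mv; apply: lb_le_inf => [|_ [v vq <-]]; last exact: Mv.
by have [v vq] := quotient_proj_surj q; exists `|v|, v.
Qed.

(** * Interpolating elements of [c0] by continuous functions on small sets *)

Section interpolation.
Context {R : realType} {d : Order.disp_t} {K : porderType d} (treeK : compact_tree K).
Context (kappa : Type) (kappaP : uncountable_regular_cardinal kappa).
Local Notation T := (interval_space K).
Local Notation CK := (contfun R (compact_tree_compact treeK)).
Local Notation L := (Lambda K kappa).
Implicit Types (f : CK) (s t x y : T) (S : set T) (h : c0 R L) (e : R).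

Definition extend h t : R^o := oapp h 0 (insub t).

Lemma extend_val h (t : L) : extend h (val t) = h t.
Proof. by rewrite /extend valK. Qed.

Lemma extendN h t : ~ L t -> extend h t = 0.
Proof. by move=> tL; rewrite /extend insubN//; apply/negP => /set_mem. Qed.

Lemma extend_le h t : `|extend h t| <= `|h|.
Proof.
rewrite /extend; case: insubP => [u _ _|_] /=; first exact: c0_le_norm.
by rewrite normr0.
Qed.

Lemma extendP a h h' t : extend (a *: h + h') t = a *: extend h t + extend h' t.
Proof. by rewrite /extend; case: insubP => //= _; rewrite scaler0 addr0. Qed.

Lemma extend_finite h e : 0 < e -> finite_set [set t | e <= `|extend h t|].
Proof.
move=> e0; have hfin := set_mem (c0P h) e e0.
apply: sub_finite_set (finite_image val hfin) => t /=.
rewrite /extend; case: insubP => [u uL <- eu|_]; first by exists u.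
by rewrite /= normr0 leNgt e0.
Qed.

(* The choice of [s t] makes [S] miss the open interval from [s t] to [t]; moreover
   a member [lower i] of a finite cover meets [{x | s t < x <= t}] only if it contains
   [t], which makes these sets disjoint for incomparable points. *)
Lemma extend_interpolation h S : S #< [set: kappa] ->
  exists f, (forall x, S x -> f x = extend h x) /\ `|f| <= `|h|.
Proof.
move=> Sk; have [D Dcov] := tree_finite_cover treeK.
have /choice[s sP] t : exists s, L t -> [/\ (s < t)%O,
    forall x, (s < x < t)%O -> ~ S x &
    forall x i, (s < x <= t)%O -> i \in D -> (x <= i)%O -> (t <= i)%O].
  have [tL|?] := pselect (L t); last by exists t.
  have [s0 s0t] : exists s0, (s0 < t)%O.
    have [tm|//] := minimalVlt t; have tP := Lambda_proper kappaP tL.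
    by exfalso; apply: (@filter_not_empty _ t^'); exact/dnbhs_set1/open_minimal.
  have tS : nbhs t [set x | x != t -> ~ S x] by exact: Lambda_gap tL Sk.
  (* For [i] not above [t], the complement of the closed set [lower i] is a neighbourhood of [t];
     finitely many of these are intersected. *)
  have tD : nbhs t (\bigcap_(i in [set` D]) [set x | (x <= i)%O -> (t <= i)%O]).
    apply: filter_bigI => i iD; have [ti|nti] := pselect (t <= i)%O.
      by apply: filterE => x.
    have : nbhs t (~` lower i).
      by apply: open_nbhs_nbhs; split=> //; exact/closed_openC/closed_lower.
    by apply: filterS => x nxi /nxi.
  have [r [_ rt rP]] := nbhs_tree treeK s0t (filterI tS tD).
  exists r => _; split=> // [x /andP[rx xt]|x i rxt iD].
    have [|+ _] := rP x; first by rewrite /= rx ltW.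
    by apply; rewrite lt_eqF.
  by have [_ /(_ _ iD)] := rP x rxt.
pose B t := [set x | (s t < x <= t)%O].
have disj t t' x : S t -> L t -> S t' -> L t' -> B t x -> B t' x -> t = t'.
  wlog suff le : t t' / S t -> L t -> S t' -> L t' -> B t x -> B t' x -> (t' <= t)%O.
    by move=> St tL St' t'L Btx Bt'x; apply/le_anti; rewrite !le.
  move=> St tL St' t'L Btx Bt'x; apply: contrapT => nle.
  (* An [i] above [t] is also above [t'], so the two points are comparable. If [t < t'], then [t] is
     a point of [S] strictly between [s t'] and [t'], which is excluded. *)
  have [i iD ti] := Dcov t.
  have /andP[_ xt] := Btx.
  have [_ t'S t'D] := sP _ t'L.
  have t'i : (t' <= i)%O by apply: t'D Bt'x iD _; exact: le_trans xt ti.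
  have tt' := tree_nle_lt treeK t'i ti nle.
  apply: (t'S t) => //; rewrite tt' andbT.
  by have /andP[/lt_le_trans + _] := Bt'x; apply.
(* The function [f0] is constantly [extend h t] on each [B t] with [t] in [S] and [L], and [0]
   elsewhere. *)
have /choice[f0 f0P] x : exists r : R^o,
    (forall t, S t -> L t -> B t x -> r = extend h t) /\
    ((forall t, S t -> L t -> ~ B t x) -> r = 0).
  have [[t [St tL Btx]]|nt] := pselect (exists t, [/\ S t, L t & B t x]).
    exists (extend h t); split=> [t' St' t'L Bt'x|/(_ t St tL)//].
    by congr extend; exact: (disj _ _ x).
  by exists 0; split=> // t St tL Btx; exfalso; apply: nt; exists t.
(* Inside some [B t] the function is locally constant. At any other point, only finitely many sets
   [B t] carry a value of size at least [e], and they are closed. *)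
have f0c : continuous f0.
  move=> x; have [[t [St tL Btx]]|nt] := pselect (exists t, [/\ S t, L t & B t x]).
    rewrite /continuous_at ((f0P x).1 t)//; apply: (@cvg_near_cst _ _ _ _ (nbhs x)).
    have : nbhs x (B t) by apply: open_nbhs_nbhs; split=> //; exact: open_oc.
    by apply: filterS => y Bty; rewrite ((f0P y).1 t).
  rewrite /continuous_at (f0P x).2 => [|t St tL Btx]; last by apply: nt; exists t.
  apply/(@cvgrPdist_le _ _ _ (nbhs x) _) => e e0.
  have /finite_fsetP[E EE] := extend_finite h e0.
  have : nbhs x (\bigcap_(t in [set` E]) [set y | S t -> L t -> ~ B t y]).
    apply: filter_bigI => t tE.
    have [[St tL]|nSL] := pselect (S t /\ L t); last first.
      by apply: filterE => y St tL; exfalso; apply: nSL.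
    have : nbhs x (~` B t).
      apply: open_nbhs_nbhs; split; last by move=> Btx; apply: nt; exists t.
      by apply: closed_openC; apply: (clopen_oc treeK _).2; rewrite ltW//; have [] := sP t tL.
    by apply: filterS => y nBty _ _.
  apply: filterS => y yE; rewrite sub0r normrN.
  have [[t [St tL Bty]]|nt'] := pselect (exists t, [/\ S t, L t & B t y]).
    rewrite ((f0P y).1 t)// leNgt; apply/negP => lt.
    have tE : [set` E] t by rewrite -EE /=; exact: ltW.
    exact: yE tE St tL Bty.
  by rewrite (f0P y).2 ?normr0 ?ltW// => t St tL Bty; apply: nt'; exists t.
have [f fE] := @contfun_exists _ _ (compact_tree_compact treeK) _ f0c.
exists f; split=> [x Sx|].
  rewrite fE; have [xL|nxL] := pselect (L x).
    by rewrite ((f0P x).1 x)// /B/= lexx andbT; have [] := sP x xL.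
  rewrite extendN// (f0P x).2// => t St tL /andP[sx xt].
  have [xEt|xNt] := eqVneq x t; first by apply: nxL; rewrite xEt.
  have [_ /(_ x) + _] := sP _ tL; apply=> //.
  by rewrite sx lt_neqAle xNt.
apply: contfun_norm_le => // x; rewrite fE.
have [[t [St tL Btx]]|nt] := pselect (exists t, [/\ S t, L t & B t x]).
  by rewrite ((f0P x).1 t)//; exact: extend_le.
by rewrite (f0P x).2 ?normr0// => t St tL Btx; apply: nt; exists t.
Qed.

(** Since only finitely many values of [extend h] have size at least [e], its punctured limit is [0]
    at [t]. *)
Lemma jump_extend h t : L t -> jump (extend h) t = extend h t.
Proof.
move=> tL; rewrite (@cvg_jump _ _ _ _ kappaP _ _ 0)// ?subr0//.
apply/cvgrPdist_lt => e e0.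
have /finite_fsetP[E EE] := extend_finite h e0.
have : nbhs t (\bigcap_(x in [set` E]) [set y | y != t -> y != x]).
  apply: filter_bigI => x xE; have [<-|tNx] := eqVneq t x; first by apply: filterE => y.
  have : nbhs t (~` [set x]).
    apply: open_nbhs_nbhs; split; last by move=> /eqP; exact/negP.
    apply: closed_openC; apply: accessible_closed_set1.
    exact/hausdorff_accessible/(compact_tree_hausdorff treeK).
  by apply: filterS => y /eqP yNx _.
move=> tE; apply: dnbhsS tE _ => y yE yNt; rewrite sub0r normrN ltNge; apply/negP => ey.
have : [set` E] y by rewrite -EE.
by move=> /yE /(_ yNt); rewrite eqxx.
Qed.

End interpolation.

(** * The jump map on [Delta] and its linear right inverse *)

Section Delta_jump.
Context {R : realType} {d : Order.disp_t} {K : porderType d} (treeK : compact_tree K).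
Context (kappa : Type) (kappaP : uncountable_regular_cardinal kappa).
Local Notation T := (interval_space K).
Local Notation CK := (contfun R (compact_tree_compact treeK)).
Local Notation L := (Lambda K kappa).
Local Notation DeltaK := (Delta CK kappa).
Implicit Types (f : CK) (t x : T) (S : set T) (h : c0 R L) (phi : dual CK) (z w : DeltaK).

Definition dirac_val (z : dual (dual CK)) : T -> R^o := fun t => z (dirac t).

Lemma dirac_val_approximable (z : dual (dual CK)) : z \in Delta_pred kappa ->
  approximable treeK kappa (dirac_val z).
Proof.
move=> zD e S e0 Sk.
have [f fz] := Delta_approx zD e0 (image_small (fun x => dirac x : dual CK) Sk).
exists f => x Sx; rewrite -[f x]/(dirac x f) (le_trans (fz _ _))//; first by exists x.
by rewrite ler_piMr ?dirac_norm// ltW.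
Qed.

(** Let a countable [S] determine [phi]. A function [g] that nearly represents [z] at [phi] and at
    the Dirac functionals of [S] is close to [f] on [S], so [phi g] is close to both [z phi] and
    [phi f]. *)
Lemma Delta_eq_embed (z : dual (dual CK)) f : z \in Delta_pred kappa ->
  (forall t, dirac_val z t = f t) -> z = bidual_embed f.
Proof.
move=> zD zf; apply/val_inj/funext => phi; rewrite -[RHS]/(phi f).
apply/eqP; rewrite -subr_eq0 -normr_le0; apply/ler_addgt0Pr => e e0; rewrite add0r.
have [S cS Sphi] := countably_determined phi.
pose r := e / 2 / (`|phi| + 1).
have p0 : 0 < `|phi| + 1 by rewrite ltr_wpDl.
have r0 : 0 < r by rewrite !divr_gt0.
have re : `|phi| * r <= e / 2.
  rewrite /r mulrCA ler_piMr//; first by rewrite divr_ge0// ltW.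
  by rewrite ler_pdivrMr// mul1r lerDl.
have [g gz] := Delta_approx zD r0 (setU_small kappaP
  (countable_small kappaP (countable1 phi))
  (image_small (fun x => dirac x : dual CK) (countable_small kappaP cS))).
have zg : `|z phi - phi g| <= `|phi| * r by rewrite mulrC; apply: gz; left.
have gf : `|phi (g - f)| <= `|phi| * r.
  apply: (determines_le Sphi) => [|x Sx]; first exact: ltW.
  rewrite -[X in `|X|]/(g x - f x) -zf distrC.
  have := gz (dirac x); rewrite diracE => /(_ _)/le_trans; apply.
    by right; exists x.
  by rewrite ler_piMr ?dirac_norm// ltW.
rewrite linearB /= in gf.
rewrite -(subrKA (phi g)) (le_trans (ler_normD _ _))// (splitr e) lerD//.
  exact: le_trans zg re.
exact: le_trans gf re.
Qed.

Definition Delta_jump z : c0 R L :=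
  C0 (jump_c0 kappaP (dirac_val_approximable (subspaceP z))).

Lemma Delta_jumpE z (t : L) : Delta_jump z t = jump (dirac_val (val z)) (val t).
Proof. by []. Qed.

Lemma Delta_jump_linear : linear Delta_jump.
Proof.
move=> a z w; apply/val_inj/funext => t.
rewrite -[RHS]/(a *: Delta_jump z t + Delta_jump w t) -[LHS]/(Delta_jump _ t) !Delta_jumpE.
have zA := dirac_val_approximable (subspaceP z).
have wA := dirac_val_approximable (subspaceP w).
have -> : dirac_val (val (a *: z + w)) = a *: dirac_val (val z) + dirac_val (val w).
  by apply/funext => x; rewrite /dirac_val linearP.
exact: (jumpP kappaP a zA wA (set_valP t)).
Qed.

Lemma Delta_jump_norm_le z : `|Delta_jump z| <= 2 * `|z|.
Proof.
apply: c0_norm_le => [|t]; first by rewrite mulr_ge0.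
rewrite Delta_jumpE mulr_natl mulr2n.
apply: (jump_le kappaP (dirac_val_approximable (subspaceP z)) (set_valP t)) => x.
by rewrite (le_trans (dual_le_norm _ _))// -[leRHS]mulr1 ler_wpM2l// dirac_norm.
Qed.

Lemma Delta_jump_eq0 z : (Delta_jump z = 0) <-> z \in @X_in_Delta _ _ kappa.
Proof.
rewrite inE; split=> [z0|[f _ <-]]; last first.
  apply/val_inj/funext => t; rewrite -[LHS]/(Delta_jump _ t) Delta_jumpE.
  apply: (jump_continuous kappaP (set_valP t)).
  exact: (@contfun_continuous _ _ _ f).
have zA := dirac_val_approximable (subspaceP z).
have [|f fE] := @contfun_exists _ _ (compact_tree_compact treeK) (dirac_val (val z)).
  apply: (approximable_continuous kappaP zA) => t tL.
  have /(congr1 (fun h : c0 R L => h (SigSub (mem_set tL)))) := z0.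
  by rewrite Delta_jumpE.
exists f => //; apply: val_inj => /=.
by apply/esym/Delta_eq_embed => [|t]; [exact: subspaceP|rewrite fE].
Qed.

(** The value of [G h] at [phi] is [phi] of an interpolant of [extend h] on a countable set
    determining [phi]. It does not depend on the interpolant, which yields linearity in [phi] and in
    [h]. *)
Lemma Delta_lift : exists G : c0 R L -> DeltaK, [/\ linear G,
  (forall h, `|G h| <= `|h|) & cancel G Delta_jump].
Proof.
have /choice[S SP] phi : exists S, countable S /\ determines S phi.
  by have [S cS Sphi] := countably_determined phi; exists S.
have Sk phi : S phi #< [set: kappa] by exact: countable_small (SP phi).1.
have [F FP] : exists F : c0 R L -> set T -> CK, forall h S', S' #< [set: kappa] ->
    (forall x, S' x -> F h S' x = extend h x) /\ `|F h S'| <= `|h|.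
  have /choice[F FP] (hS : c0 R L * set T) : exists f : CK, hS.2 #< [set: kappa] ->
      (forall x, hS.2 x -> f x = extend hS.1 x) /\ `|f| <= `|hS.1|.
    have [Sk'|?] := pselect (hS.2 #< [set: kappa]); last by exists 0.
    by have [f fP] := extend_interpolation treeK kappaP hS.1 Sk'; exists f.
  by exists (fun h S' => F (h, S')) => h S'; exact: (FP (h, S')).
pose G0 h phi : R^o := phi (F h (S phi)).
(* any interpolant of [extend h] on a small determining set computes [G0 h phi] *)
have G0E h phi S' f : S' #< [set: kappa] -> determines S' phi ->
    (forall x, S' x -> f x = extend h x) -> phi f = G0 h phi.
  move=> S'k S'phi fh.
  have [gE _] := FP h (S' `|` S phi) (setU_small kappaP S'k (Sk phi)).
  rewrite (determines_eq (g := F h (S' `|` S phi)) S'phi) => [|x S'x]; last first.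
    by rewrite fh// gE//; left.
  apply: (determines_eq (SP phi).2) => x Sx; rewrite gE; last by right.
  by have [-> ] := FP h (S phi) (Sk phi).
have G0lin h : linear (G0 h).
  suff G0P a phi psi : G0 h (a *: phi + psi) = a *: G0 h phi + G0 h psi by exact: G0P.
  (* One interpolant on a common determining set computes all three values, and linearity of
     evaluation finishes. *)
  pose S' := S phi `|` (S psi `|` S (a *: phi + psi)).
  have S'k : S' #< [set: kappa] by do 2! apply: setU_small => //.
  have [fE _] := FP h S' S'k.
  have G0S chi : S chi `<=` S' -> chi (F h S') = G0 h chi.
    by move=> SS'; apply: (G0E h chi S' _ S'k _ fE); exact: determinesS (SP chi).2.
  have <- : (a *: phi + psi) (F h S') = G0 h (a *: phi + psi).
    by apply: G0S => x ?; right; right.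
  have <- : phi (F h S') = G0 h phi by apply: G0S => x ?; left.
  by have <- : psi (F h S') = G0 h psi by apply: G0S => x ?; right; left.
have G0le h phi : `|G0 h phi| <= `|h| * `|phi|.
  rewrite (le_trans (dual_le_norm _ _))// mulrC ler_wpM2r//.
  by have [] := FP h (S phi) (Sk phi).
pose G1 h : dual (dual CK) := Dual (dual_predP (G0lin h) (G0le h)).
have G1D h : G1 h \in Delta_pred kappa.
  rewrite inE; apply: subset_closure => A Ak.
  (* By regularity a single interpolant serves all of [A], so [G1 h] already lies in [Delta0]. *)
  have Ik : \bigcup_(phi in A) S phi #< [set: kappa] by apply: bigcup_small.
  have [fE _] := FP h _ Ik; exists (F h (\bigcup_(phi in A) S phi)) => phi Aphi.
  apply/esym/(G0E h phi _ _ Ik _ fE).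
  by apply: determinesS (SP phi).2 => x ?; exists phi.
exists (fun h => Subspace (G1D h)); split=> [a h h'|h|h].
- apply/val_inj/val_inj/funext => phi.
  rewrite -[LHS]/(G0 _ phi) -[RHS]/(a *: G0 h phi + G0 h' phi).
  rewrite /G0 -linearP; apply/esym.
  apply: (G0E _ phi (S phi)) => [||x Sx]; [exact: Sk|exact: (SP phi).2|].
  rewrite extendP -[LHS]/(a *: F h (S phi) x + F h' (S phi) x).
  have [-> // _] := FP h (S phi) (Sk phi).
  by have [-> // _] := FP h' (S phi) (Sk phi).
- by apply: dual_norm_le => // phi; exact: G0le.
- apply/val_inj/funext => t; rewrite -[LHS]/(Delta_jump _ t) Delta_jumpE.
  have -> : dirac_val (val (Subspace (G1D h))) = extend h.
    apply/funext => x; rewrite -[LHS]/(G0 h (dirac x)); apply/esym.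
    have xk := countable_small kappaP (countable1 x).
    have [fE _] := FP h [set x] xk.
    rewrite -(fE x erefl) -diracE; apply: (G0E h (dirac x) _ _ xk _ fE).
    exact: determines_dirac.
  by rewrite jump_extend ?extend_val//; exact: set_valP.
Qed.

End Delta_jump.

(** * The isomorphism induced by the jump map on the quotient *)

Theorem theorem6p6 (R : realType) (d : Order.disp_t) (K : porderType d)
    (treeK : compact_tree K) (kappa : Type)
    (kappaP : uncountable_regular_cardinal kappa) :
  linearly_isomorphic
    (S_space (contfun R (compact_tree_compact treeK)) kappa)
    (c0 R (Lambda K kappa)).
Proof.
set CK := contfun R (compact_tree_compact treeK).
pose proj : Delta CK kappa -> S_space CK kappa :=
  @quotient_proj _ _ _ (@X_in_Delta_closed R CK kappa).
pose J : Delta CK kappa -> c0 R (Lambda K kappa) := Delta_jump kappaP.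
pose J' : {linear Delta CK kappa -> c0 R (Lambda K kappa)} :=
  HB.pack J (GRing.isLinear.Build _ _ _ _ J (Delta_jump_linear (treeK := treeK) kappaP)).
have projP : linear proj by exact: quotient_proj_linear.
(* Both maps have kernel [X_in_Delta], so [J] is constant on the fibres of [proj] and separates
   them. *)
have proj_eqP z w : proj z = proj w <-> J z = J w.
  split=> [/eq_quotientP|] zw.
    by apply/eqP; rewrite -subr_eq0 -(linearB J'); apply/eqP/Delta_jump_eq0.
  apply/eq_quotientP/(@Delta_jump_eq0 _ _ _ _ _ kappaP).
  by rewrite -[LHS]/(J' (z - w)) linearB; apply/eqP; rewrite subr_eq0; apply/eqP.
have [G [Glin Gle GK]] := @Delta_lift R d K treeK kappa kappaP.
have /choice[rep repK] q : exists z, proj z = q by exact: quotient_proj_surj.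
have Jproj z : J (rep (proj z)) = J z by apply/proj_eqP.
pose f q := J (rep q).
have flin : linear f.
  move=> a q r; rewrite -[q in LHS]repK -[r in LHS]repK /f -projP Jproj.
  exact: Delta_jump_linear.
pose f' : {linear S_space CK kappa -> c0 R (Lambda K kappa)} :=
  HB.pack f (GRing.isLinear.Build _ _ _ _ f flin).
pose g h := proj (G h).
have glin : linear g by move=> a h h'; rewrite /g Glin projP.
pose g' : {linear c0 R (Lambda K kappa) -> S_space CK kappa} :=
  HB.pack g (GRing.isLinear.Build _ _ _ _ g glin).
exists f', g'; split.
- by move=> q; rewrite -[LHS]/(proj (G (J (rep q)))) -[RHS]repK; apply/proj_eqP/GK.
- by move=> h; rewrite -[LHS]/(J (rep (proj (G h)))) Jproj; exact: GK.
- apply: (@linear_le_continuous _ _ _ f' 2) => q.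
  (* The bound with constant [2] holds for every representative [z] of [q], hence passes to the
     infimum defining the quotient norm. *)
  rewrite mulrC -ler_pdivrMr//; apply: le_quotient_norm => z <-.
  by rewrite ler_pdivrMr// mulrC -[f' _]/(J (rep (proj z))) Jproj; exact: Delta_jump_norm_le.
- apply: (@linear_le_continuous _ _ _ g' 1) => h; rewrite mul1r.
  exact: le_trans (quotient_proj_norm_le _ _) (Gle h).
Qed.
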